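(* Let $X$ be a minimal shift space. The following are equivalent: (1) $X$ is eventually dendric; (2) there exists a nonempty $w\in\mathcal{L}(X)$ such that the derived shift $\mathcal{D}_w(X)$ is dendric; (3) there exists $N$ such that for every $w\in\mathcal{L}(X)$ with $|w|\ge N$, the derived shift $\mathcal{D}_w(X)$ is dendric.
   Context: Shift spaces over a finite alphabet $\mathcal{A}$: nonempty closed shift-invariant subsets of $\mathcal{A}^{\mathbb{Z}}$ with language $\mathcal{L}(X)$; minimal: no nonempty proper closed shift-invariant subset. For $w\in\mathcal{L}(X)$: $E^L_X(w)=\{a:aw\in\mathcal{L}(X)\}$, $E^R_X(w)=\{b:wb\in\mathcal{L}(X)\}$; $\mathcal{E}_X(w)$ is the bipartite graph on disjoint copies of these with an edge $\{a^L,b^R\}$ whenever $awb\in\mathcal{L}(X)$; $w$ is dendric if $\mathcal{E}_X(w)$ is a tree; $X$ is dendric if all its words are dendric and eventually dendric if all words of length at least some $N$ are dendric. For nonempty $w\in\mathcal{L}(X)$, a return word to $w$ is a nonempty word $r$ with $rw\in\mathcal{L}(X)$ such that $rw$ contains exactly two occurrences of $w$, one as prefix and one as suffix; for minimal $X$ the set $\mathcal{R}_X(w)$ of return words is finite. Let $R(w)=\{1,\dots,|\mathcal{R}_X(w)|\}$ and let $\theta:R(w)^*\to\mathcal{A}^*$ be a morphism mapping $R(w)$ bijectively onto $\mathcal{R}_X(w)$ (a coding morphism). The derived shift is $\mathcal{D}_w(X)=\{x\in R(w)^{\mathbb{Z}}:\theta(x)\in X\}$ (defined up to a permutation of $R(w)$).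 *)

(* Defs.v *)
From mathcomp Require Import all_boot all_order all_algebra.
From mathcomp Require Import boolp.
Set Implicit Arguments. Unset Strict Implicit. Unset Printing Implicit Defensive.
Import GRing.Theory Num.Theory.
Local Open Scope ring_scope.

Definition config (A : Type) := int -> A.

Definition shift (A : Type) (x : config A) : config A := fun i => x (i + 1).

Definition window (A : Type) (x : config A) (i : int) (n : nat) : seq A :=
  mkseq (fun j => x (i + j%:Z)) n.

Section Shifts.
Variable A : finType.

(* closed for the product topology (A discrete): every point all of whose
   central cylinders meet X lies in X *)
Definition closed_set (X : config A -> Prop) : Prop :=
  forall x : config A,
    (forall n : nat, exists y, X y /\ forall i : int,
        - (n%:Z) <= i <= n%:Z -> x i = y i) -> X x.

Definition shift_invariant (X : config A -> Prop) : Prop :=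
  forall x : config A, X x <-> X (shift x).

Definition shift_space (X : config A -> Prop) : Prop :=
  (exists x, X x) /\ closed_set X /\ shift_invariant X.

Definition minimal (X : config A -> Prop) : Prop :=
  shift_space X /\
  forall Y : config A -> Prop, shift_space Y -> (forall x, Y x -> X x) ->
    forall x, X x -> Y x.

Definition inL (X : config A -> Prop) (w : seq A) : Prop :=
  exists x i, X x /\ window x i (size w) = w.

(* extension graph of w: vertices inl a (left copy) and inr b (right copy) *)
Definition ext_vertex (X : config A -> Prop) (w : seq A) : pred (A + A) :=
  fun v => match v with
           | inl a => `[< inL X (a :: w) >]
           | inr b => `[< inL X (rcons w b) >]
           end.

Definition ext_edge (X : config A -> Prop) (w : seq A) : rel (A + A) :=
  fun u v => match u, v with
             | inl a, inr b => `[< inL X (a :: rcons w b) >]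
             | inr b, inl a => `[< inL X (a :: rcons w b) >]
             | _, _ => false
             end.

Definition is_tree (T : finType) (V : pred T) (e : rel T) : Prop :=
  (exists v, V v) /\
  (forall u v, V u -> V v ->
     exists p : seq T, [/\ path e u p, last u p = v & all V p]) /\
  (forall c : seq T, all V c -> 3 <= size c -> ~ ucycle e c)%N.

Definition dendric_word (X : config A -> Prop) (w : seq A) : Prop :=
  is_tree (ext_vertex X w) (ext_edge X w).

Definition dendric (X : config A -> Prop) : Prop :=
  forall w, inL X w -> dendric_word X w.

Definition eventually_dendric (X : config A -> Prop) : Prop :=
  exists N : nat, forall w, inL X w -> (N <= size w)%N -> dendric_word X w.

Definition occurrences (w u : seq A) : nat :=
  count (fun i => take (size w) (drop i u) == w) (iota 0 (size u - size w).+1).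

Definition return_word (X : config A -> Prop) (w r : seq A) : Prop :=
  r != [::] /\ inL X (r ++ w) /\ prefix w (r ++ w) /\
  occurrences w (r ++ w) = 2%N.

Definition coding_morphism (X : config A -> Prop) (w : seq A) (n : nat)
    (theta : 'I_n -> seq A) : Prop :=
  injective theta /\ forall r, return_word X w r <-> exists i, theta i = r.

End Shifts.

(* position in theta(y) at which the block theta(y_k) starts
   (theta(y_0) starts at 0) *)
Definition block_start (A : Type) (n : nat) (theta : 'I_n -> seq A)
    (y : config 'I_n) (k : int) : int :=
  match k with
  | Posz m => (\sum_(j < m) size (theta (y j%:Z)))%N%:Z
  | Negz m => - ((\sum_(j < m.+1) size (theta (y (- (j.+1)%:Z))))%N%:Z)
  end.

(* the derived shift D_w(X) = { y in R(w)^Z : theta(y) in X } *)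
Definition derived_shift (A : finType) (X : config A -> Prop) (n : nat)
    (theta : 'I_n -> seq A) : config 'I_n -> Prop :=
  fun y => exists x, X x /\ forall k : int,
      window x (block_start theta y k) (size (theta (y k))) = theta (y k).

(* "the derived shift D_w(X) is dendric" (D_w(X) is defined up to a
   permutation of R(w); dendricity does not depend on that choice) *)
Definition derived_dendric (A : finType) (X : config A -> Prop) (w : seq A)
  : Prop :=
  exists (n : nat) (theta : 'I_n -> seq A),
    coding_morphism X w theta /\ dendric (derived_shift X theta).

(* Main.v *)
Require Import Defs.
From mathcomp Require Import all_boot all_order all_algebra.
From mathcomp Require Import boolp zify.
Set Implicit Arguments. Unset Strict Implicit. Unset Printing Implicit Defensive.

(** For u in the language of D_w(X), the extension graph of u is the extension
    graph of v = theta(u)w in which left letters are replaced by return words r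
    and right letters by the words p with wp a complete return word.  These form
    a suffix code and a prefix code, so this graph arises from the letter graph
    by repeatedly replacing a vertex by a tree on its neighbours, which
    preserves trees: if long words of X are dendric, so is D_w(X).
    Conversely, in an eventually dendric language the number of left extensions
    minus one is additive over right extensions, so along long words it is
    eventually carried by a single right extension; with the mirror statement,
    extension graphs of long words are double stars.  A long word of X is
    z = p theta(u) w q with u long, and its extension graph is the image of the
    double star of u under partial maps of the vertices, again a tree.
    Trees are handled through mod-2 cohomology. *)

(** * Bipartite trees and mod-2 potentials *)

(** Levi's lemma. *)
Lemma cat_eq_cat (T : Type) (a b c d : seq T) : a ++ b = c ++ d ->
  (exists e, c = a ++ e /\ b = e ++ d) \/ (exists e, a = c ++ e /\ d = e ++ b).
Proof.
elim: a c => [|x a IH] [|y c] /=.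
- by move=> ->; left; exists [::].
- by move=> ->; left; exists (y :: c).
- by move=> <-; right; exists (x :: a).
- by case=> -> /IH [] [e [-> ->]]; [left | right]; exists e.
Qed.

Lemma cat_injr (T : Type) (a b c : seq T) : a ++ c = b ++ c -> a = b.
Proof.
move=> /(congr1 (fun s => take (size s - size c) s)).
by rewrite !size_cat !addnK !take_size_cat.
Qed.

(* A bipartite graph without isolated vertices is connected iff its mod-2
   cohomology in degree 0 consists of the constants, and acyclic iff its mod-2
   cohomology in degree 1 vanishes. *)
Definition treelike (I J : Type) (E : I -> J -> Prop) : Prop :=
  (forall (f : I -> bool) (g : J -> bool), (forall i j, E i j -> f i = g j) ->
     exists c, forall i j, E i j -> f i = c) /\
  (forall h : I -> J -> bool, exists f g,
     forall i j, E i j -> f i (+) g j = h i j).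

Section Treelike.
Variables I J : Type.
Implicit Types E : I -> J -> Prop.

Lemma treelike_ext E E' :
  (forall i j, E i j <-> E' i j) -> treelike E -> treelike E'.
Proof.
move=> EE' [E1 E2]; split=> [f g fg | h].
  have [|c cP] := E1 f g; first by move=> i j /EE'; apply: fg.
  by exists c => i j /EE'; apply: cP.
by have [f [g fgP]] := E2 h; exists f, g => i j /EE'; apply: fgP.
Qed.

Lemma treelike_sym E : treelike E -> treelike (fun j i => E i j).
Proof.
move=> [E1 E2]; split=> [f g fg | h].
  have [|c cP] := E1 g f; first by move=> i j /fg.
  by exists c => j i Eij; rewrite (fg _ _ Eij) (cP _ _ Eij).
have [f [g fgP]] := E2 (fun i j => h j i).
by exists g, f => j i /fgP; rewrite addbC.
Qed.

Lemma treelike_star E (i0 : I) : (forall i j, E i j -> i = i0) -> treelike E.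
Proof.
move=> Ei0; split=> [f g fg | h].
  by exists (f i0) => i j /Ei0 ->.
by exists (fun=> false), (h i0) => i j /Ei0 ->.
Qed.

Lemma treelike_empty E : (forall i j, ~ E i j) -> treelike E.
Proof.
move=> E0; split=> [f g fg | h]; first by exists true => i j /E0.
by exists (fun=> true), (fun=> true) => i j /E0.
Qed.

(** If there is an edge at all, [i0] and [j0] are adjacent and all other vertices are leaves. The
    potential is read off at the centres, corrected by [h i0 j0] so that the central edge counts
    once. *)
Lemma treelike_double_star E (i0 : I) (j0 : J) :
  (forall i j, E i j -> i = i0 \/ j = j0) ->
  (forall i j, E i j -> E i j0) -> (forall i j, E i j -> E i0 j) -> treelike E.
Proof.
move=> E0 Ej Ei; split=> [f g fg | h].
  exists (f i0) => i j Eij; rewrite (fg _ _ (Ej _ _ Eij)).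
  by rewrite (fg _ _ (Ei _ _ (Ej _ _ Eij))).
pose g j := h i0 j.
exists (fun i => h i j0 (+) h i0 j0), g => i j /E0 [->|->].
  by rewrite addbb.
by rewrite -addbA addbb addbF.
Qed.

End Treelike.

(* Each left vertex of a tree may be replaced by a tree on its neighbours. *)
Lemma treelike_subst (I I' J : Type) (E : I -> J -> Prop) (E' : I' -> J -> Prop)
    (r : I' -> I) :
  (forall i j, E' i j -> E (r i) j) ->
  (forall i j, E i j -> exists i', r i' = i /\ E' i' j) ->
  (forall i, treelike (fun i' j => r i' = i /\ E' i' j)) ->
  treelike E -> treelike E'.
Proof.
move=> EE' E'E H [E1 E2]; split=> [f g fg | h].
  have /choice[c cP] : forall i, exists c, forall i' j,
      r i' = i /\ E' i' j -> f i' = c.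
    by move=> i; have [H1 _] := H i; apply: (H1 f g) => i' j [_ /fg].
  have [|d dP] := E1 c g.
    move=> i j /E'E [i' [ri' Ei'j]].
    by rewrite -(fg _ _ Ei'j) (cP i i' j).
  exists d => i j Eij; rewrite (cP (r i) i j) //.
  exact: dP (EE' _ _ Eij).
have /choice[a aP] : forall i, exists ab : (I' -> bool) * (J -> bool),
    forall i' j, r i' = i /\ E' i' j -> ab.1 i' (+) ab.2 j = h i' j.
  by move=> i; have [_ /(_ h) [f [g fgP]]] := H i; exists (f, g).
(* The right halves of the fibre potentials form an edge function of [E], whose potential reconciles
   the fibres. *)
have [f [g fgP]] := E2 (fun i => (a i).2).
exists (fun i' => (a (r i')).1 i' (+) f (r i')), g => i j Eij.
by rewrite -addbA (fgP _ _ (EE' _ _ Eij)) aP.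
Qed.

(** As [r] is injective on non-isolated vertices, each fibre is a star or empty. *)
Lemma treelike_transport (I I' J : Type) (E : I -> J -> Prop)
    (E' : I' -> J -> Prop) (r : I' -> I) :
  (forall i j, E' i j -> E (r i) j) ->
  (forall i j, E i j -> exists i', r i' = i /\ E' i' j) ->
  (forall i1 i2 j1 j2, E' i1 j1 -> E' i2 j2 -> r i1 = r i2 -> i1 = i2) ->
  treelike E -> treelike E'.
Proof.
move=> EE' E'E rI; apply: treelike_subst EE' E'E _ => i.
have [[i1 [j1 [ri1 E1]]]|no] := EM (exists i1 j1, r i1 = i /\ E' i1 j1).
  apply: (@treelike_star _ _ _ i1) => i2 j2 [ri2 E2].
  by apply: rI E2 E1 _; rewrite ri1.
by apply: treelike_empty => i1 j1 P; apply: no; exists i1, j1.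
Qed.

(** The words of [S] are grown leftwards from the empty word. A suffix [t] outside [S] has a tree of
    letters in front of it, where each [a :: t] is replaced by the tree of the words of [S] ending
    in it; [K] bounds the depth. *)
Lemma treelike_suffix_code (A J : Type) (E : seq A -> J -> Prop)
    (S : seq A -> Prop) (K : nat) :
  (forall a s j, E (a :: s) j -> E s j) ->
  (forall s j, E s j -> exists a, E (a :: s) j) ->
  (forall s t, S (s ++ t) -> S t -> s = [::]) ->
  (forall t j, E t j -> K <= size t -> exists s1 s2, t = s1 ++ s2 /\ S s2) ->
  (forall t, treelike (fun i j => (exists a, i = a :: t) /\ E i j)) ->
  treelike (fun s j => S s /\ E s j).
Proof.
move=> Edec Eext Scode Scompl Elet.
have Ecat s t j : E (s ++ t) j -> E t j by elim: s => //= a s IH /Edec.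
have Elong n t j : E t j -> exists s, n <= size s /\ E (s ++ t) j.
  move=> Et; elim: n => [|n [s [sn /Eext[a Ea]]]]; first by exists [::].
  by exists (a :: s).
(* [n] bounds the letters still to be added; the second hypothesis says that no proper suffix of [t]
   lies in [S]. *)
suff main n t : K <= n + size t ->
    (forall s1 s2, t = s1 ++ s2 -> S s2 -> s1 = [::]) ->
    treelike (fun s j => (S s /\ E s j) /\ exists s1, s = s1 ++ t).
  apply: treelike_ext (main K [::] _ _); first last.
  - by case.
  - by rewrite addn0.
  - by move=> s j; split=> [[] //|SE]; split=> //; exists s; rewrite cats0.
elim: n t => [|n IH] t Kt tmin.
all: have [St|nSt] := EM (S t).
- apply: (@treelike_star _ _ _ t) => s j [[Ss _] [s1 s1P]].
  by rewrite s1P in Ss *; rewrite (Scode _ _ Ss St).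
- apply: treelike_empty => s j [[Ss Es] [s1 s1P]].
  rewrite s1P in Es; have [u1 [u2 [tE Su2]]] := Scompl _ _ (Ecat _ _ _ Es) Kt.
  by move: (tmin _ _ tE Su2) => u10; rewrite u10 /= in tE; rewrite -tE in Su2.
- apply: (@treelike_star _ _ _ t) => s j [[Ss _] [s1 s1P]].
  by rewrite s1P in Ss *; rewrite (Scode _ _ Ss St).
(* The suffix one letter longer than [t], which is the vertex that [s] replaces. *)
pose r (s : seq A) := drop (size s - (size t).+1) s.
have rP s1 a : r (s1 ++ a :: t) = a :: t.
  by rewrite /r size_cat /= addnK drop_size_cat.
have sP s j : (S s /\ E s j) /\ (exists s1, s = s1 ++ t) ->
    exists s1 a, s = s1 ++ a :: t.
  move=> [[Ss Es] [s1 sE]]; case/lastP: s1 sE => [|s1 a] sE.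
    by rewrite sE in Ss.
  by exists s1, a; rewrite sE cat_rcons.
apply: (treelike_subst (r := r)) (Elet t).
- move=> s j H; have [s1 [a sE]] := sP _ _ H.
  move: H => [[Ss Es] _]; rewrite sE rP; split; first by exists a.
  by apply: (Ecat s1); rewrite -sE.
(* A long left extension of [a :: t] has a suffix in [S]; no suffix of [t] qualifies, so it ends in
   [a :: t]. *)
- move=> i j [[a ->] Ea]; have [s [Ks Es]] := Elong K _ _ Ea.
  have [|s1 [s2 [sE Ss2]]] := Scompl _ _ Es.
    by rewrite size_cat; apply: leq_trans (leq_addr _ _).
  have E2 : E s2 j by apply: (Ecat s1); rewrite -sE.
  have [[[|b e] [s1E s2E]]|[e [s1E s2E]]] := cat_eq_cat sE.
  + exists (a :: t); split; first exact: (rP [::]).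
    by split; [rewrite s2E | exists [:: a]].
  + move: s2E => /= [_ tE]; have e0 := tmin _ _ tE Ss2.
    by rewrite e0 /= in tE; rewrite -tE in Ss2.
  exists s2; rewrite s2E rP -s2E; split=> //; split=> //.
  by exists (rcons e a); rewrite cat_rcons.
move=> i; have [[a iE]|ni] := EM (exists a, i = a :: t).
  have at_min s1 s2 : a :: t = s1 ++ s2 -> S s2 -> s1 = [::].
    case: s1 => //= b s1 [_ tE] Ss2; have s10 := tmin _ _ tE Ss2.
    by rewrite s10 /= in tE; rewrite -tE in Ss2.
  have Kat : K <= n + size (a :: t) by rewrite /= addnS -addSn.
  apply: treelike_ext (IH (a :: t) Kat at_min) => s j; split.
    move=> [SE [s1 sE]]; rewrite {1}sE rP iE; split=> //; split=> //.
    by exists (rcons s1 a); rewrite cat_rcons.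
  move=> [rs H]; have [s1 [b sE]] := sP _ _ H.
  split; first by case: H.
  by exists s1; move: rs; rewrite sE rP iE => ->.
apply: treelike_empty => s j [rs H]; have [s1 [b sE]] := sP _ _ H.
by apply: ni; exists b; rewrite -rs sE rP.
Qed.

Lemma uniq_ends (T : eqType) (x y z : T) (p : seq T) :
  uniq (x :: z :: rcons p y) -> [/\ x != z, x \notin rcons p y & z != y].
Proof.
rewrite /= inE negb_or => /andP[/andP[-> ->]].
by rewrite mem_rcons inE negb_or => /andP[/andP[-> _] _].
Qed.

(** * Graph-theoretic trees and Euler's formula *)

Section FiniteTree.
Variables (A B : finType) (V : pred (A + B)) (e : rel (A + B)).
Variable E : A -> B -> Prop.
Hypothesis e_lr : forall a b, e (inl a) (inr b) <-> E a b.
Hypothesis e_sym : symmetric e.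
Hypothesis e_ll : forall a a', e (inl a) (inl a') = false.
Hypothesis e_rr : forall b b', e (inr b) (inr b') = false.
Hypothesis eV : forall v, V v <-> exists u, e v u.

Let pot (f : A -> bool) (g : B -> bool) (v : A + B) :=
  match v with inl a => f a | inr b => g b end.

Let e_ind (P : A + B -> A + B -> Prop) : (forall u v, P u v -> P v u) ->
  (forall a b, E a b -> P (inl a) (inr b)) -> forall u v, e u v -> P u v.
Proof.
move=> Psym PE [a|b] [a'|b'].
- by rewrite e_ll.
- by move/e_lr; apply: PE.
- by rewrite e_sym => /e_lr /PE /Psym.
- by rewrite e_rr.
Qed.

Lemma connected_potential : (exists v, V v) ->
  (forall u v, V u -> V v ->
     exists p : seq (A + B), [/\ path e u p, last u p = v & all V p]) ->
  forall (f : A -> bool) (g : B -> bool), (forall i j, E i j -> f i = g j) ->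
     exists c, forall i j, E i j -> f i = c.
Proof.
move=> [v0 Vv0] conn f g fg; exists (pot f g v0) => i j Eij.
have Vi : V (inl i) by apply/eV; exists (inr j); apply/e_lr.
have [p [ep lp _]] := conn _ _ Vv0 Vi.
have pote : forall u v, e u v -> pot f g u = pot f g v by apply: e_ind.
have -> : f i = pot f g (last v0 p) by rewrite lp.
by elim: p v0 ep {Vv0 lp} => //= x p IH v0 /andP[/pote -> /IH].
Qed.

(** Edges are added one at a time. A new edge joins two distinct components, since otherwise it
    would close a cycle, so the potential can be corrected on one of them. *)
Lemma acyclic_potential :
  (forall c : seq (A + B), all V c -> (3 <= size c)%N -> ~ ucycle e c) ->
  forall h : A -> B -> bool, exists f g,
     forall i j, E i j -> f i (+) g j = h i j.
Proof.
move=> acyc h; suff main (s : seq (A * B)) : exists (f : A -> bool) g,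
    forall i j, (i, j) \in s -> E i j -> f i (+) g j = h i j.
  have [f [g fgP]] := main (enum {: A * B}).
  by exists f, g => i j; apply: fgP; rewrite mem_enum.
elim: s => [|[a b] s [f [g fgP]]]; first by exists (fun=> true), (fun=> true).
have [[Eab abs]|nab] := EM (E a b /\ (a, b) \notin s); last first.
  exists f, g => i j; rewrite inE => /orP[/eqP[-> ->] Eab|]; last exact: fgP.
  by apply: fgP => //; apply: contra_notT nab.
pose ins u v := match u, v with
  | inl i, inr j | inr j, inl i => (i, j) \in s | _, _ => false end.
pose e' := [rel u v | ins u v && e u v].
have e's : connect_sym e'.
  by apply: sym_connect_sym => -[i|j] [i'|j'] //=; rewrite e_sym.
pose C := connect e' (inl a).
have Ce i j : (i, j) \in s -> E i j -> C (inl i) = C (inr j).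
  by move=> ijs /e_lr Eij; apply: (same_connect_r e's); apply: connect1; rewrite /= ijs.
have nC : C (inr b) = false.
  apply/negP => /connectP[p0 ep0 lp0].
  move: lp0; case/shortenP: ep0 => p ep up _ lp.
  have eep : path e (inl a) p by apply: sub_path ep => u v /andP[].
  have ba : e (inr b) (inl a) by rewrite e_sym; apply/e_lr.
  have aa : e (inl a) (inr b) by apply/e_lr.
  have allV q : forall x, path e x q -> all V q.
    elim: q => //= y q IH x /andP[exy /IH ->]; rewrite andbT.
    by apply/eV; exists x; rewrite e_sym.
  apply: (acyc (inl a :: p)).
  - rewrite /= (allV _ _ eep) andbT; apply/eV; by exists (inr b).
  (* A shorter cycle would make [(a, b)] an earlier edge. *)
  - case: p lp ep {up eep} => [|x [|y p]] //= <-.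
    by rewrite (negbTE abs).
  - by rewrite /ucycle up andbT /= rcons_path eep -lp.
(* The error on the new edge; adding it on the component of [a] affects both ends of every earlier
   edge alike. *)
pose d := f a (+) g b (+) h a b.
exists (fun i => f i (+) (d && C (inl i))), (fun j => g j (+) (d && C (inr j))).
move=> i j; rewrite inE => /orP[/eqP[-> ->] _|ijs Eij].
  rewrite nC andbF addbF /C connect0 andbT /d.
  by case: (f a) (g b) (h a b) => [] [] [].
rewrite -(fgP _ _ ijs Eij) (Ce _ _ ijs Eij).
by case: (f i) (g j) (_ && _) => [] [] [].
Qed.

(** The degree-0 condition is applied to the indicator function of the component of [u]. *)
Lemma treelike_connected : treelike E -> forall u v, V u -> V v ->
  exists p : seq (A + B), [/\ path e u p, last u p = v & all V p].
Proof.
move=> [E1 _] u v /eV[u' uu'] /eV[v' vv'].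
have es : connect_sym e by apply: sym_connect_sym.
pose C := connect e u.
have Ce x y : e x y -> C x = C y.
  by move=> exy; apply: (same_connect_r es); apply: connect1.
have [|c cP] := E1 (fun i => C (inl i)) (fun j => C (inr j)).
  by move=> i j /e_lr /Ce.
have Cc : forall x y, e x y -> C x = c /\ C y = c.
  apply: e_ind => [x y [] // | a b Eab].
  by rewrite -(Ce _ _ (iffRL (e_lr a b) Eab)) (cP _ _ Eab).
have : C v by rewrite (Cc _ _ vv').1 -(Cc _ _ uu').1 /C connect0.
case/connectP=> p ep lp; exists p; split=> //.
elim: p u ep {lp uu' C Ce cP Cc} => //= y p IH x /andP[exy /IH ->].
by rewrite andbT; apply/eV; exists x; rewrite e_sym.
Qed.

(** For the indicator [h] of one edge of a cycle, a potential is constant along the rest of the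
    cycle, yet must differ at the two ends of that edge. *)
Lemma treelike_acyclic : treelike E ->
  forall c : seq (A + B), all V c -> (3 <= size c)%N -> ~ ucycle e c.
Proof.
move=> [_ E2] [|x p] //= _; case/lastP: p => // p y; case: p => // z p _.
case/andP; rewrite /= rcons_path last_rcons => /and3P[exz ep eyx].
case/uniq_ends => nxz xp nzy.
pose h a b := ((inl a == x) && (inr b == y)) || ((inl a == y) && (inr b == x)).
have [f [g fgP]] := E2 h; pose P := pot f g.
have hP : forall u v, e u v ->
    P u (+) P v = ((u == x) && (v == y)) || ((u == y) && (v == x)).
  apply: e_ind => [u v H | a b /fgP //].
  by rewrite addbC H orbC; congr (_ || _); rewrite andbC.
have step u v : e u v -> x != u -> x != v -> P u = P v.
  move=> /hP; rewrite [u == x]eq_sym [v == x]eq_sym => H /negbTE xu /negbTE xv.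
  by move: H; rewrite xu xv andbF; case: (P u) (P v) => [] [].
have Pxz : P x = P z.
  move: (hP _ _ exz); rewrite (negbTE nzy) [z == x]eq_sym (negbTE nxz) !andbF.
  by case: (P x) (P z) => [] [].
have Pzy : P z = P (last z (rcons p y)).
  elim: (rcons p y) z ep nxz xp {exz nzy Pxz} => //= u q IH z.
  move=> /andP[ezu equ] xz; rewrite inE negb_or => /andP[xu xq].
  by rewrite (step _ _ ezu xz xu) IH.
by move: (hP _ _ eyx); rewrite Pxz Pzy last_rcons addbb !eqxx orbT.
Qed.

Lemma is_tree_treelike : (exists v, V v) -> is_tree V e <-> treelike E.
Proof.
move=> V0; split=> [[_ [conn acyc]]|tE].
  by split; [apply: connected_potential | apply: acyclic_potential].
by split=> //; split; [apply: treelike_connected | apply: treelike_acyclic].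
Qed.

End FiniteTree.

(** Euler's formula for a tree. The coboundary [d] maps vertex sets avoiding the base vertex [a0]
    bijectively onto edge sets: it is injective by the degree-0 condition and surjective by the
    degree-1 condition. *)
Lemma treelike_card (A B : finType) (E : A -> B -> bool) :
  treelike E -> (exists a b, E a b) ->
  (\sum_b #|[pred a | E a b]|).+1 =
    #|[pred a | [exists b, E a b]]| + #|[pred b | [exists a, E a b]]|.
Proof.
move=> [E1 E2] [a0 [b0 E00]].
pose V := [set v : A + B | match v with inl a => [exists b, E a b]
                                      | inr b => [exists a, E a b] end].
pose D := V :\ inl a0; pose EE := [set ab : A * B | E ab.1 ab.2].
pose d (h : {set A + B}) := [set ab : A * B |
   E ab.1 ab.2 && ((inl ab.1 \in h) (+) (inr ab.2 \in h))].
have Va a b : E a b -> inl a \in V by move=> Eab; rewrite inE; apply/existsP; exists b.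
have Vb a b : E a b -> inr b \in V by move=> Eab; rewrite inE; apply/existsP; exists a.
have dI : {in powerset D &, injective d}.
  move=> h1 h2; rewrite !inE => /subsetP h1D /subsetP h2D eqd.
  pose f v := (v \in h1) (+) (v \in h2).
  have fE a b : E a b -> f (inl a) = f (inr b).
    move=> Eab; have := congr1 (fun s : {set A * B} => (a, b) \in s) eqd.
    rewrite !inE /= Eab /= /f; move: (_ \in _) (_ \in _) (_ \in _) (_ \in _).
    by do 4 case.
  have nD h : {subset h <= D} -> inl a0 \in h = false.
    by move=> hD; apply/negP => /hD; rewrite !inE eqxx.
  have [c cP] := E1 (fun a => f (inl a)) (fun b => f (inr b)) fE.
  have c0 : c = false by rewrite -(cP _ _ E00) /f !nD.
  have fV v : v \in V -> f v = false.
    case: v => x; rewrite inE => /existsP[y Exy].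
      by rewrite (cP _ _ Exy).
    by rewrite -(fE _ _ Exy) (cP _ _ Exy).
  apply/setP => v; have [vV|nvV] := boolP (v \in V).
    by move: (fV v vV); rewrite /f; case: (_ \in h1) (_ \in h2) => [] [].
  by rewrite (contraNF (h1D v)) ?(contraNF (h2D v)) // in_setD1 negb_and nvV orbT.
have dS : d @: powerset D = powerset EE.
  apply/setP => g; rewrite inE; apply/imsetP/subsetP => [[h _ ->] ab|gE].
    by rewrite !inE => /andP[].
  have [f1 [f2 fP]] := E2 (fun a b => (a, b) \in g).
  pose f v := match v with inl a => f1 a | inr b => f2 b end.
  exists [set v in V | f v (+) f1 a0].
    rewrite inE; apply/subsetP => v; rewrite !inE => /andP[vV fv].
    by rewrite vV andbT; apply: contraTneq fv => ->; rewrite /f addbb.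
  apply/setP => -[a b]; rewrite [RHS]inE /=.
  have [Eab|nEab] := boolP (E a b); last first.
    by apply/negP => /gE; rewrite inE (negbTE nEab).
  rewrite !inE /=.
  have := Va _ _ Eab; have := Vb _ _ Eab; rewrite !inE => -> ->.
  rewrite -(fP _ _ Eab).
  by case: (f1 a) (f2 b) (f1 a0) => [] [] [].
have card_eq : #|D| = #|EE|.
  by apply/eqP; rewrite -(eqn_exp2l _ _ (ltnSn 1)) -!card_powerset -dS card_in_imset.
have cV : #|V| = #|[pred a | [exists b, E a b]]| + #|[pred b | [exists a, E a b]]|.
  rewrite -sum1_card big_sumType /= -!sum1_card.
  by congr (_ + _); apply: eq_bigl => x; rewrite !inE.
rewrite -cV (cardsD1 (inl a0)) (Va _ _ E00) add1n -/D card_eq.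
congr _.+1; rewrite cardsE -sum1_card.
rewrite (eq_bigr (fun b => \sum_(a | E a b) 1)); last first.
  by move=> b _; rewrite -sum1_card.
by rewrite (exchange_big_dep xpredT) //= pair_big_dep.
Qed.

(** * Languages *)

(** Factorial bi-extendable languages: a setting that covers both [X] and its derived shift and is
    stable under reversal. *)
Record is_language (A : Type) (L : seq A -> Prop) : Prop := IsLanguage {
  lang_factor : forall p u q, L (p ++ u ++ q) -> L u;
  lang_extl : forall u, L u -> exists a, L (a :: u);
  lang_extr : forall u, L u -> exists b, L (rcons u b) }.

Definition ext (A : Type) (L : seq A -> Prop) (w : seq A) : A -> A -> Prop :=
  fun a b => L (a :: rcons w b).

Definition revL (A : Type) (L : seq A -> Prop) : seq A -> Prop :=
  fun u => L (rev u).

Section Language.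
Variables (A : Type) (L : seq A -> Prop).
Hypothesis HL : is_language L.

Lemma lang_suffix p u : L (p ++ u) -> L u.
Proof. by move=> Lu; apply: (lang_factor HL (p := p) (q := [::])); rewrite cats0. Qed.

Lemma lang_prefix u q : L (u ++ q) -> L u.
Proof. exact: (lang_factor HL (p := [::])). Qed.

Lemma is_language_rev : is_language (revL L).
Proof.
split=> [p u q|u /(lang_extr HL)[a La]|u /(lang_extl HL)[a La]].
- by rewrite /revL !rev_cat -catA => /(lang_factor HL).
- by exists a; rewrite /revL rev_cons.
- by exists a; rewrite /revL rev_rcons.
Qed.

Lemma lang_extl_long n u : L u -> exists t, n <= size t /\ L (t ++ u).
Proof.
elim: n u => [|n IH] u Lu; first by exists [::].
have [a /IH [t [nt Lt]]] := lang_extl HL Lu.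
by exists (rcons t a); rewrite size_rcons ltnS cat_rcons.
Qed.

Lemma ext_rev w a b : ext (revL L) (rev w) a b <-> ext L w b a.
Proof. by rewrite /ext /revL rev_cons rev_rcons revK. Qed.

Lemma treelike_ext_rev w :
  treelike (ext L w) -> treelike (ext (revL L) (rev w)).
Proof.
move=> /treelike_sym; apply: treelike_ext => a b.
by symmetry; apply: ext_rev.
Qed.

End Language.

Lemma lang_extr_long (A : Type) (L : seq A -> Prop) n u : is_language L ->
  L u -> exists t, n <= size t /\ L (u ++ t).
Proof.
move=> HL Lu; have Lru : revL L (rev u) by rewrite /revL revK.
have [t [nt Lt]] := lang_extl_long (is_language_rev HL) n Lru.
by exists (rev t); rewrite size_rev; move: Lt; rewrite /revL rev_cat revK.
Qed.

(** * Left extensions along long words *)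

Section EventuallyStar.
Variables (A : finType) (L : seq A -> Prop) (N : nat).
Hypothesis HL : is_language L.
Hypothesis tree : forall w, L w -> N <= size w -> treelike (ext L w).

Let lext w := [pred a | `[< L (a :: w) >]].

(** The truncated predecessor gives degree 0 to words outside [L], so sums may run over all
    letters. *)
Let deg w := #|lext w|.-1.

Let lext_sub w b : {subset lext (rcons w b) <= lext w}.
Proof.
move=> a; rewrite !inE => /asboolP La; apply/asboolP.
by apply: (lang_prefix HL (q := [:: b])); rewrite cats1.
Qed.

(** Counting edges by right vertex gives [deg (rcons w b) + 1] for each right extension [b]; in
    Euler's formula the number of right extensions cancels. *)
Lemma sum_deg w : N <= size w -> \sum_b deg (rcons w b) = deg w.
Proof.
move=> Nw; have [Lw|nLw] := EM (L w); last first.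
  have deg0 u : ~ L u -> deg u = 0.
    move=> nLu; rewrite /deg (eq_card0 (A := lext u)) // => a.
    rewrite !inE; apply/asboolP => La; apply: nLu.
    by apply: (lang_suffix HL (p := [:: a])).
  rewrite deg0 // big1 // => b _; apply: deg0 => Lb; apply: nLw.
  by apply: (lang_prefix HL (q := [:: b])); rewrite cats1.
pose E a b := `[< L (a :: rcons w b) >].
have [b0 Lb0] := lang_extr HL Lw; have [a0 Lab0] := lang_extl HL Lb0.
have tE : treelike E.
  by apply: treelike_ext (tree Lw Nw) => a b; rewrite /E; split=> /asboolP.
have := treelike_card tE (ex_intro _ a0 (ex_intro _ b0 (asboolT Lab0))).
have -> : #|[pred a | [exists b, E a b]]| = #|lext w|.
  apply: eq_card => a; rewrite !inE; apply/existsP/asboolP => [[b /asboolP Lab]|La].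
    by apply: (lang_prefix HL (q := [:: b])); rewrite cats1.
  by have [b Lab] := lang_extr HL La; exists b; apply/asboolP.
pose r := [pred b | [exists a, E a b]].
have lb b : #|[pred a | E a b]| = deg (rcons w b) + r b.
  have -> : #|[pred a | E a b]| = #|lext (rcons w b)| by apply: eq_card.
  rewrite /deg /r /=; case: existsP => [[a Ea]|nE].
    rewrite addn1 prednK //; apply/card_gt0P; by exists a.
  by rewrite eq_card0 // => a; apply/negP => Ea; apply: nE; exists a.
rewrite (eq_bigr (fun b => deg (rcons w b) + r b)) => [|b _]; last exact: lb.
rewrite big_split /=.
have -> : \sum_b nat_of_bool (r b) = #|r|.
  rewrite -sum1_card [RHS]big_mkcond; apply: eq_bigr => b _.
  by rewrite -[b \in r]/(r b); case: (r b).
have l0 : 0 < #|lext w|.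
  apply/card_gt0P; exists a0; rewrite inE; apply/asboolP.
  by apply: (lang_prefix HL (q := [:: b0])); rewrite cats1.
by rewrite -/r /deg; move: l0; lia.
Qed.

Let stable w := deg w = 0 \/ exists b, deg (rcons w b) = deg w.

Let evs w := exists M, forall v, M <= size v -> stable (w ++ v).

Let deg_le w b : N <= size w -> deg (rcons w b) <= deg w.
Proof. by move=> /sum_deg <-; rewrite (bigD1 b) //= leq_addr. Qed.

Let deg_sibling w b b' : N <= size w -> deg (rcons w b) = deg w -> b' != b ->
  deg (rcons w b') = 0.
Proof.
move=> /sum_deg E bE nb; move: E; rewrite (bigD1 b) //= (bigD1 b') //= bE.
by lia.
Qed.

Lemma evs_branch w : (forall b, evs (rcons w b)) -> evs w.
Proof.
move=> /choice[M MP]; exists (\max_b M b).+1 => -[//|b v].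
rewrite /= ltnS -cat_rcons => Mv; apply: MP.
exact: leq_trans (leq_bigmax b) Mv.
Qed.

Lemma evs_deg0 w : N <= size w -> deg w = 0 -> evs w.
Proof.
move=> Nw w0; exists 0 => v _; left; elim/last_ind: v => [|v b IH].
  by rewrite cats0.
apply/eqP; rewrite -leqn0 -rcons_cat -IH; apply: deg_le.
by rewrite size_cat; apply: leq_trans Nw (leq_addr _ _).
Qed.

(* deg is nonincreasing along right extensions, and a word keeping its degree
   has a single right extension of positive degree. *)
Lemma evs_long w : N <= size w -> evs w.
Proof.
move: {2}(deg w) (leqnn (deg w)) => n; elim: n w => [|n IH] w dw Nw.
  by apply: evs_deg0 => //; apply/eqP; rewrite -leqn0.
have Ncat v : N <= size (w ++ v).
  by rewrite size_cat; apply: leq_trans Nw (leq_addr _ _).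
(* Either some extension of full degree loses degree under every letter, and induction applies to
   its one-letter extensions, or all extensions have degree [deg w] or 0 and are stable. *)
have [[v [dv nv]]|no] := EM (exists v, deg (w ++ v) = deg w /\
    forall b, deg (rcons (w ++ v) b) <> deg (w ++ v)).
  have : evs (w ++ v).
    apply: evs_branch => b; apply: IH.
      rewrite -ltnS; apply: leq_trans dw; rewrite -dv ltn_neqAle deg_le // andbT.
      by apply/eqP.
    by rewrite size_rcons; apply: leq_trans (Ncat v) _.
  (* Climbing back from [w ++ v] to [w], the siblings of the path have degree 0. *)
  elim/last_ind: v dv {nv} => [|v b IHv]; first by rewrite cats0.
  rewrite -rcons_cat => dvb evb.
  have dv : deg (w ++ v) = deg w.
    apply/eqP; rewrite eqn_leq -{2}dvb deg_le // andbT.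
    elim/last_ind: (v) => [|v' b' IHv']; first by rewrite cats0.
    by rewrite -rcons_cat; apply: leq_trans (deg_le _ _) IHv'.
  apply: (IHv dv); apply: evs_branch => b'.
  have [->//|nb] := eqVneq b' b.
  apply: evs_deg0; last by apply: (@deg_sibling (w ++ v) b) => //; rewrite dvb dv.
  by rewrite size_rcons; apply: leq_trans (Ncat v) _.
exists 0 => v _.
have all_deg u : deg (w ++ u) = deg w ->
    exists b, deg (rcons (w ++ u) b) = deg (w ++ u).
  move=> du; have [//|nb] := EM (exists b, deg (rcons (w ++ u) b) = deg (w ++ u)).
  by case: no; exists u; split=> // b db; apply: nb; exists b.
have : deg (w ++ v) = deg w \/ deg (w ++ v) = 0.
  elim/last_ind: v => [|v b [dv|dv]]; first by rewrite cats0; left.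
    have [b' db'] := all_deg _ dv; rewrite -rcons_cat.
    have [->|nb] := eqVneq b b'; first by left; rewrite db'.
    by right; apply: deg_sibling nb.
  by right; apply/eqP; rewrite -leqn0 -rcons_cat -dv deg_le.
by case=> [/all_deg|] ?; [right | left].
Qed.

Lemma evs_all w : evs w.
Proof.
move: {2}(N - size w) (erefl (N - size w)) => n.
elim: n w => [|n IH] w Nw; first by apply: evs_long; lia.
by apply: evs_branch => b; apply: IH; rewrite size_rcons; lia.
Qed.

(** [b0] carries the full degree, so it admits every left extension, while the other letters, of
    degree 0, admit at most one. In degree 0 any right extension serves as [b0]. *)
Lemma eventually_right_star : exists M, forall w, L w -> M <= size w ->
  exists b0, (forall a b, ext L w a b -> ext L w a b0) /\
    (forall a a' b, b <> b0 -> ext L w a b -> ext L w a' b -> a = a').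
Proof.
have [M MP] := evs_all [::]; exists (maxn M N) => w Lw.
rewrite geq_max => /andP[/MP /= st Nw].
have lextP a b : ext L w a b -> a \in lext (rcons w b).
  by move=> Lab; rewrite inE; apply/asboolP.
have deg0_eq u : deg u = 0 -> {in lext u &, forall x y, x = y}.
  move=> d0 x y xu yu; suff /card_le1_eqP le1 : #|lext u| <= 1 by apply: le1.
  by move: d0; rewrite /deg; lia.
have [d0|dn0] := eqVneq (deg w) 0.
  have [b0 /(lang_extl HL)[a0 La0]] := lang_extr HL Lw; exists b0; split.
    move=> a b /lextP /lext_sub aw; suff -> : a = a0 by [].
    by apply: (deg0_eq w) => //; apply: lext_sub (lextP _ _ La0).
  move=> a a' b _ /lextP /lext_sub aw /lextP /lext_sub a'w.
  exact: (deg0_eq w).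
case: st => [d0|[b0 db0]]; first by rewrite d0 in dn0.
exists b0; split=> [a b /lextP /lext_sub aw|a a' b nb /lextP aw /lextP a'w].
  have /subset_cardP : #|lext (rcons w b0)| = #|lext w|.
    by move: db0 dn0; rewrite /deg; lia.
  move=> /(_ (introT subsetP (@lext_sub w b0))) eqb.
  by move: aw; rewrite -eqb inE => /asboolP.
by apply: deg0_eq aw a'w; apply: deg_sibling db0 _ => //; apply/eqP.
Qed.

End EventuallyStar.

(** An edge off both centres would give its left letter, different from [a0], a second right
    neighbour [b0], against the mirrored statement. *)
Lemma eventually_double_star (A : finType) (L : seq A -> Prop) (N : nat) :
  is_language L ->
  (forall w, L w -> N <= size w -> treelike (ext L w)) ->
  exists M, forall w, L w -> M <= size w -> exists a0 b0,
    [/\ forall a b, ext L w a b -> a = a0 \/ b = b0,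
        forall a b, ext L w a b -> ext L w a b0 &
        forall a b, ext L w a b -> ext L w a0 b].
Proof.
move=> HL tree; have [M MP] := eventually_right_star HL tree.
have [|M' MP'] := eventually_right_star (N := N) (is_language_rev HL).
  move=> w Lw Nw; rewrite -[w]revK; apply: treelike_ext_rev.
  by apply: tree; rewrite ?size_rev.
exists (maxn M M') => w Lw; rewrite geq_max => /andP[/(MP _ Lw) [b0 [b1 b2]]].
rewrite -size_rev => /MP' []; first by rewrite /revL revK.
move=> a0 [a1 a2]; exists a0, b0; split=> // a b ab.
  have [->|nb] := EM (b = b0); [by right | left].
  have [//|na] := EM (a = a0); case: nb.
  by apply: (a2 b b0 a) => //; apply/ext_rev => //; apply: b1 ab.
by apply/ext_rev/(a1 b a)/ext_rev.
Qed.

(** * Return words and derived languages *)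

(** The word [r ++ w] is used in place of [r] because the notion is then symmetric under
    reversal. *)
Definition complete_return (A : Type) (L : seq A -> Prop) (w c : seq A) :=
  [/\ L c, exists r, r <> [::] /\ c = r ++ w, exists p, p <> [::] /\ c = w ++ p
    & forall p q, c = p ++ w ++ q -> p = [::] \/ q = [::]].

Definition recurrent_word (A : Type) (L : seq A -> Prop) (K : nat) (w : seq A) :=
  forall u, L u -> K <= size u -> exists p q, u = p ++ w ++ q.

Lemma complete_return_rev (A : Type) (L : seq A -> Prop) (w c : seq A) :
  complete_return L w c -> complete_return (revL L) (rev w) (rev c).
Proof.
have rev0 (s : seq A) : rev s = [::] -> s = [::] by move/(congr1 rev); rewrite revK.
case=> Lc [r [r0 cr]] [p [p0 cp]] H; split.
- by rewrite /revL revK.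
- by exists (rev p); rewrite cp rev_cat; split=> // /rev0.
- by exists (rev r); rewrite cr rev_cat; split=> // /rev0.
move=> x y /(congr1 rev); rewrite revK !rev_cat revK -catA => /H.
by case=> /rev0 ->; [right | left].
Qed.

Lemma recurrent_word_rev (A : Type) (L : seq A -> Prop) (K : nat) (w : seq A) :
  recurrent_word L K w -> recurrent_word (revL L) K (rev w).
Proof.
move=> H u Lu Ku; have [|p [q E]] := H _ Lu; first by rewrite size_rev.
by exists (rev q), (rev p); rewrite -[u]revK E !rev_cat catA.
Qed.

(** * Return words as suffix and prefix codes *)

Section Return.
Variables (A : Type) (L : seq A -> Prop) (w : seq A) (K : nat).
Hypothesis HL : is_language L.
Hypothesis w0 : w <> [::].
Hypothesis recw : recurrent_word L K w.

(** [t ++ w] begins with [w] and is longer, so this occurrence is not a suffix of the long word and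
    must be its prefix. *)
Lemma return_suffix_code s t : complete_return L w ((s ++ t) ++ w) ->
  complete_return L w (t ++ w) -> s = [::].
Proof.
move=> [_ _ _ H] [_ _ [p [p0 tp]] _].
by case: (H s p) => //; rewrite -catA tp.
Qed.

(** As long as there is an interior occurrence of [w], everything before it is cut off. *)
Lemma return_suffix s p : L (s ++ w) -> s <> [::] -> s ++ w = w ++ p ->
  exists s1 s2, s = s1 ++ s2 /\ complete_return L w (s2 ++ w).
Proof.
move: {2}(size s) (leqnn (size s)) => n; elim: n s p => [|n IH] s p.
  by case: s.
move=> sn Ls s0 sp.
have [[x [y [x0 y0 xy]]]|no] :=
    EM (exists x y, [/\ x <> [::], y <> [::] & s ++ w = x ++ w ++ y]).
  have [[e [xe we]]|[e [se we]]] := cat_eq_cat xy.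
    have /(congr1 size) : w = (e ++ w) ++ y by rewrite -catA.
    by rewrite !size_cat; case: (y) y0 => // c y' _ /=; lia.
  have e0 : e <> [::].
    move=> E; apply: y0; move/(congr1 size): we.
    by rewrite E size_cat; case: (y) => //= c y' ; lia.
  have [||//|//|s1 [s2 [es cr]]] := IH e y.
  - by move: sn; rewrite se size_cat; case: (x) x0 => //= c x' _; lia.
  - by apply: (lang_suffix HL (p := x)); rewrite catA -se.
  by exists (x ++ s1), s2; rewrite se es catA.
exists [::], s; split=> //; split=> //.
- by exists s.
- exists p; split=> // E; apply: s0; move/(congr1 size): sp.
  by rewrite E cats0 size_cat; case: (s) => //= c s'; lia.
move=> x y xy; have [->|x0] := EM (x = [::]); first by left.
have [->|y0] := EM (y = [::]); first by right.
by case: no; exists x, y.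
Qed.

(** Recurrence puts [w] inside [t], so [t ++ w] ends with a longer word that begins and ends with
    [w]. *)
Lemma return_suffix_complete t : L (t ++ w) -> K <= size t ->
  exists s1 s2, t = s1 ++ s2 /\ complete_return L w (s2 ++ w).
Proof.
move=> Lt Kt; have [p [q tE]] := recw (lang_prefix HL Lt) Kt.
have [|||s1 [s2 [E cr]]] := @return_suffix (w ++ q) (q ++ w).
- by apply: (lang_suffix HL (p := p)); rewrite catA -tE.
- by case: (w) w0.
- by rewrite catA.
by exists (p ++ s1), s2; rewrite tE E catA.
Qed.

End Return.

Section ReturnRight.
Variables (A : Type) (L : seq A -> Prop) (w : seq A) (K : nat).
Hypothesis HL : is_language L.
Hypothesis w0 : w <> [::].
Hypothesis recw : recurrent_word L K w.

Let w0' : rev w <> [::].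
Proof. by move/(congr1 rev); rewrite revK. Qed.

(** Through this equivalence the statements on suffixes become statements on prefixes. *)
Lemma return_right_rev p : complete_return L w (w ++ p) <->
  complete_return (revL L) (rev w) (rev p ++ rev w).
Proof.
split; first by move/complete_return_rev; rewrite rev_cat.
move/complete_return_rev; rewrite rev_cat !revK; congr complete_return.
by apply/funext => u; rewrite /revL revK.
Qed.

Lemma return_prefix_code s t : complete_return L w (w ++ t ++ s) ->
  complete_return L w (w ++ t) -> s = [::].
Proof.
move=> /return_right_rev; rewrite rev_cat => H1 /return_right_rev H2.
have := return_suffix_code H1 H2; by move/(congr1 rev); rewrite revK.
Qed.

Lemma return_prefix s p : L (w ++ p) -> p <> [::] -> w ++ p = s ++ w ->
  exists p1 p2, p = p1 ++ p2 /\ complete_return L w (w ++ p1).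
Proof.
move=> Lp p0 E.
have [|||s1 [s2 [E' cr]]] := return_suffix (is_language_rev HL) (w := rev w)
  (s := rev p) (p := rev s).
- by rewrite /revL rev_cat !revK.
- by move/(congr1 rev); rewrite revK.
- by rewrite -!rev_cat E.
exists (rev s2), (rev s1); split; first by rewrite -rev_cat -E' revK.
by apply/return_right_rev; rewrite revK.
Qed.

Lemma return_prefix_complete t : L (w ++ t) -> K <= size t ->
  exists s1 s2, t = s1 ++ s2 /\ complete_return L w (w ++ s1).
Proof.
move=> Lt Kt.
have [||s1 [s2 [E cr]]] := return_suffix_complete (is_language_rev HL) w0'
  (recurrent_word_rev recw) (t := rev t).
- by rewrite /revL rev_cat !revK.
- by rewrite size_rev.
exists (rev s2), (rev s1); split; first by rewrite -rev_cat -E revK.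
by apply/return_right_rev; rewrite revK.
Qed.

End ReturnRight.

(** [head] recovers the letter; its default [a0] comes from an existing edge. *)
Lemma treelike_head (A J : Type) (F : seq A -> J -> Prop) (t : seq A) :
  treelike (fun a j => F (a :: t) j) ->
  treelike (fun i j => (exists a, i = a :: t) /\ F i j).
Proof.
move=> tF; have [[i0 [j0 [[a0 _] _]]]|no] :=
    EM (exists i j, (exists a, i = a :: t) /\ F i j); last first.
  by apply: treelike_empty => i j P; apply: no; exists i, j.
apply: (treelike_transport (r := head a0)) tF.
- by move=> i j [[a ->]].
- by move=> a j Fa; exists (a :: t); split=> //; split=> //; exists a.
- by move=> i1 i2 _ _ [[a ->] _] [[b ->] _] /= ->.
Qed.

(* The extension graph of v with letters replaced by left and right return
   words to w. *)
Lemma treelike_return (A : Type) (L : seq A -> Prop) (N K : nat)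
    (w v v1 v2 : seq A) :
  is_language L -> (forall u, L u -> N <= size u -> treelike (ext L u)) ->
  w <> [::] -> recurrent_word L K w -> v = w ++ v1 -> v = v2 ++ w ->
  N <= size v ->
  treelike (fun s p => complete_return L w (s ++ w) /\
    (complete_return L w (w ++ p) /\ L (s ++ v ++ p))).
Proof.
move=> HL tree w0 recw vw wv Nv.
apply: (@treelike_suffix_code _ _
  (fun s p => complete_return L w (w ++ p) /\ L (s ++ v ++ p))
  (fun s => complete_return L w (s ++ w)) K).
- by move=> a s p [rp Ls]; split=> //; apply: (lang_suffix HL (p := [:: a])).
- by move=> s p [rp /(lang_extl HL)[a La]]; exists a.
- by move=> s t; apply: return_suffix_code.
- move=> t p [_ Lt]; apply: return_suffix_complete => //.
  by move: Lt; rewrite vw -catA catA => /(lang_prefix HL).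
move=> t.
apply: (treelike_head (F := fun s p => complete_return L w (w ++ p) /\ L (s ++ v ++ p))).
apply: treelike_sym.
(* Reversing the right-hand words turns the prefix code into a suffix code. *)
have /treelike_transport : treelike (fun q a =>
    complete_return L w (w ++ rev q) /\ L ((a :: t) ++ v ++ rev q)); last first.
  move=> /(_ _ (fun p a => complete_return L w (w ++ p) /\ L ((a :: t) ++ v ++ p)) rev).
  apply.
  - by move=> p a; rewrite revK.
  - by move=> q a H; exists (rev q); rewrite revK.
  - by move=> p q _ _ _ _ /(congr1 rev); rewrite !revK.
apply: (@treelike_suffix_code _ _ (fun q a => L ((a :: t) ++ v ++ rev q))
  (fun q => complete_return L w (w ++ rev q)) K).
- move=> b q a; rewrite rev_cons -cats1 !catA; exact: lang_prefix.
- move=> q a /(lang_extr HL)[b Lb]; exists b.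
  by rewrite rev_cons -!rcons_cat.
- move=> s u; rewrite rev_cat => H1 H2.
  by have := return_prefix_code H1 H2; move/(congr1 rev); rewrite revK.
- move=> q a; rewrite wv -catA catA => /(lang_suffix HL) Lq Kq.
  have [|s1 [s2 [E cr]]] := return_prefix_complete HL w0 recw Lq.
    by rewrite size_rev.
  by exists (rev s2), (rev s1); rewrite -rev_cat -E !revK.
move=> q; apply: (treelike_head (F := fun q a => L ((a :: t) ++ v ++ rev q))).
(* With both contexts fixed, this is the extension graph of [t ++ v ++ rev q], which is long enough,
   or it has no edge. *)
have [Lq|nLq] := EM (L (t ++ v ++ rev q)).
  apply/treelike_sym/(treelike_ext _ (tree _ Lq _)) => [a b|].
    by rewrite /ext rev_cons /= !rcons_cat.
  by rewrite !size_cat; lia.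
apply: treelike_empty => b a Lab; apply: nLq.
apply: (lang_factor HL (p := [:: a]) (q := [:: b])).
by move: Lab; rewrite rev_cons -cats1 /= -!catA.
Qed.

(** * The derived language and its extension graphs *)

Section DerivedLanguage.
Variables (A : Type) (L : seq A -> Prop) (w : seq A) (K n : nat).
Variable theta : 'I_n -> seq A.
Hypothesis HL : is_language L.
Hypothesis w0 : w <> [::].
Hypothesis recw : recurrent_word L K w.
Hypothesis thetaI : injective theta.
Hypothesis thetaP : forall r,
  complete_return L w (r ++ w) <-> exists i, theta i = r.

Definition decode (u : seq 'I_n) : seq A := flatten (map theta u).

(** This is the language of the derived shift, by [inL_derived_shift]; the final [w] completes the
    last return word. *)
Definition derivedL (u : seq 'I_n) : Prop := L (decode u ++ w).

Lemma decode_cat u v : decode (u ++ v) = decode u ++ decode v.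
Proof. by rewrite /decode map_cat flatten_cat. Qed.

Lemma decode_cons a u : decode (a :: u) = theta a ++ decode u.
Proof. by []. Qed.

Lemma decode_rcons u b : decode (rcons u b) = decode u ++ theta b.
Proof. by rewrite -cats1 decode_cat decode_cons /= cats0. Qed.

Lemma theta_return i : complete_return L w (theta i ++ w).
Proof. by apply/thetaP; exists i. Qed.

Lemma theta_neq0 i : theta i <> [::].
Proof.
case: (theta_return i) => _ [r [r0 E]] _ _; move=> ti; apply: r0.
by move/(congr1 size): E; rewrite ti !size_cat; case: (r) => //= a r'; lia.
Qed.

Lemma decode_prefix u : exists v, decode u ++ w = w ++ v.
Proof.
elim: u => [|a u [v E]]; first by exists [::]; rewrite cats0.
have [_ _ [p [_ ap]] _] := theta_return a.
by exists (p ++ v); rewrite decode_cons -catA E catA ap catA.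
Qed.

Lemma return_right_theta p : complete_return L w (w ++ p) ->
  exists b, theta b ++ w = w ++ p.
Proof.
move=> cp; have [_ [r [_ E]] _ _] := cp.
by move: cp; rewrite E => /thetaP[b <-]; exists b.
Qed.

(** Factors: [decode q ++ w] begins with [w]. Extensions: after [K] more letters of [X] on one side,
    a further complete return word can be cut off. *)
Lemma derived_is_language : is_language derivedL.
Proof.
split=> [p u q|u Lu|u Lu].
- rewrite /derivedL !decode_cat -!catA; have [v ->] := decode_prefix q.
  by rewrite (catA (decode u)); apply: (lang_factor HL).
- have [t [Kt Lt]] := lang_extl_long HL K Lu; have [v E] := decode_prefix u.
  have Ltw : L (t ++ w) by move: Lt; rewrite E catA => /(lang_prefix HL).
  have [s1 [s2 [tE /thetaP[a aE]]]] := return_suffix_complete HL w0 recw Ltw Kt.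
  exists a; rewrite /derivedL decode_cons aE -catA.
  by apply: (lang_suffix HL (p := s1)); rewrite catA -tE.
have [t [Kt Lt]] := lang_extr_long K HL Lu.
have Lwt : L (w ++ t) by move: Lt; rewrite -catA => /(lang_suffix HL).
have [s1 [s2 [tE cr]]] := return_prefix_complete HL w0 recw Lwt Kt.
have [b bE] := return_right_theta cr.
exists b; rewrite /derivedL decode_rcons -catA bE.
by apply: (lang_prefix HL (q := s2)); rewrite -!catA -tE catA.
Qed.

(** [treelike_return] is relabelled by the coding: by [theta] on the left, and on the right by its
    conjugate [right], for which [w ++ right b] is [theta b ++ w]. *)
Lemma derived_treelike N : (forall u, L u -> N <= size u -> treelike (ext L u)) ->
  N <= size w -> forall u, treelike (ext derivedL u).
Proof.
move=> tree Nw u; have [v1 E] := decode_prefix u.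
have Nv : N <= size (decode u ++ w) by rewrite size_cat; lia.
have tr := treelike_return HL tree w0 recw E erefl Nv.
pose right b := drop (size w) (theta b ++ w).
have rightP b : theta b ++ w = w ++ right b.
  by have [_ _ [p [_ bp]] _] := theta_return b; rewrite /right bp drop_size_cat.
have ext_right a b : ext derivedL u a b <-> L (theta a ++ (decode u ++ w) ++ right b).
  by rewrite /ext /derivedL decode_cons decode_rcons -!catA rightP.
have tl : treelike (fun a p => complete_return L w (w ++ p) /\
    L (theta a ++ (decode u ++ w) ++ p)).
  apply: (treelike_transport (r := theta)) tr.
  - by move=> a p H; split=> //; apply: theta_return.
  - by move=> s p [/thetaP[a <-] H]; exists a.
  - by move=> a b _ _ _ _ /thetaI.
apply: treelike_sym; apply: (treelike_transport (r := right)) (treelike_sym tl).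
- by move=> b a /ext_right Lab; split=> //; rewrite -rightP; apply: theta_return.
- move=> p a [/return_right_theta[b bp] Lp].
  have bE : right b = p by rewrite /right bp drop_size_cat.
  by exists b; split=> //; apply/ext_right; rewrite bE.
- move=> a b _ _ _ _ E'; apply: thetaI.
  by apply: (cat_injr (c := w)); rewrite !rightP E'.
Qed.

(** Return words are split off on the left as long as [w] recurs. *)
Lemma parse_suffix y : L (w ++ y) -> exists u q, w ++ y = decode u ++ w ++ q /\
  forall x z, w ++ q = x ++ w ++ z -> x = [::].
Proof.
move: {2}(size y) (leqnn (size y)) => m; elim: m y => [|m IH] y ym Ly.
  exists [::], y; split=> // x z /(congr1 size); rewrite !size_cat.
  by case: x => //= a x'; lia.
have [[x [z [x0 E]]]|no] := EM (exists x z, x <> [::] /\ w ++ y = x ++ w ++ z);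
  last first.
  exists [::], y; split=> // x z E; have [//|x0] := EM (x = [::]).
  by case: no; exists x, z.
have [p xp] : exists p, x ++ w = w ++ p.
  move: E; rewrite catA => E; have [[p [xw _]]|[p [wE _]]] := cat_eq_cat E.
    by exists p.
  by move/(congr1 size): wE; rewrite !size_cat; case: (x) x0 => //= a x' _; lia.
have p0 : p <> [::].
  move=> p0; apply: x0; move/(congr1 size): xp; rewrite p0 !size_cat.
  by case: (x) => //= a x'; lia.
have yE : w ++ y = w ++ p ++ z by rewrite E catA xp -catA.
have Lwp : L (w ++ p) by apply: (lang_prefix HL (q := z)); rewrite -catA -yE.
have [p1 [p2 [pE /[dup] /return_right_theta[b bE] cr]]] :=
  return_prefix HL Lwp p0 (esym xp).
have yE2 : w ++ y = theta b ++ w ++ (p2 ++ z).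
  by rewrite yE pE -catA !catA -bE -!catA.
have [||u [q [uE qP]]] := IH (p2 ++ z).
- move/(congr1 size): yE2; rewrite !size_cat.
  by case: (theta b) (@theta_neq0 b) => //= a t _; lia.
- by apply: (lang_suffix HL (p := theta b)); rewrite -yE2.
by exists (b :: u), q; rewrite yE2 uE decode_cons catA.
Qed.

Lemma first_occurrence s t : exists p y, s ++ w ++ t = p ++ w ++ y /\
  forall x z, p ++ w = x ++ w ++ z -> z = [::].
Proof.
move: {2}(size s) (leqnn (size s)) => m; elim: m s t => [|m IH] s t sm.
  exists s, t; split=> // x z /(congr1 size); rewrite !size_cat.
  by case: z => //= a x'; lia.
have [[x [z [z0 E]]]|no] := EM (exists x z, z <> [::] /\ s ++ w = x ++ w ++ z);
  last first.
  exists s, t; split=> // x z E; have [//|z0] := EM (z = [::]).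
  by case: no; exists x, z.
have [|p [y [pE pP]]] := IH x (z ++ t).
  move/(congr1 size): E; rewrite !size_cat.
  by case: (z) z0 => //= a x' _; lia.
by exists p, y; rewrite -pE catA E -!catA.
Qed.

(** The remainders [p] and [q] are shorter than [K], since otherwise they would contain [w]; hence
    the length of [z] lies in [decode u]. *)
Lemma long_parse M : exists M', forall z, L z -> M' <= size z ->
  exists p u q, [/\ z = p ++ (decode u ++ w) ++ q, M <= size u,
    forall x y, p ++ w = x ++ w ++ y -> y = [::] &
    forall x y, w ++ q = x ++ w ++ y -> x = [::]].
Proof.
pose B := \max_i size (theta i).
have decB u : size (decode u) <= size u * B.
  elim: u => // a u IH; rewrite decode_cons size_cat mulSn leq_add //.
  exact: (leq_bigmax (F := fun i => size (theta i))).
(* [K] for each remainder, [M * B] for the decoding of fewer than [M] letters. *)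
exists (K + M * B + size w + K) => z Lz zM.
have [|s [t zE]] := recw Lz; first by lia.
have [p [y [pE pP]]] := first_occurrence s t; rewrite pE in zE.
have Lwy : L (w ++ y) by apply: (lang_suffix HL (p := p)); rewrite -zE.
have [u [q [yE qP]]] := parse_suffix Lwy.
exists p, u, q; split=> //; first by rewrite zE yE -!catA.
have pK : size p < K.
  rewrite ltnNge; apply/negP => Kp.
  have [|c [d pcd]] := recw _ Kp.
    by apply: (lang_prefix HL (q := w ++ y)); rewrite -zE.
  have /pP /(congr1 size) : p ++ w = c ++ w ++ (d ++ w) by rewrite pcd -!catA.
  by rewrite size_cat; case: (w) w0 => //= a w' _; lia.
have qK : size q < K.
  rewrite ltnNge; apply/negP => Kq.
  have [|c [d pcd]] := recw _ Kq.
    by apply: (lang_suffix HL (p := decode u ++ w)); rewrite -catA -yE.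
  have /qP /(congr1 size) : w ++ q = (w ++ c) ++ w ++ d by rewrite pcd -!catA.
  by rewrite size_cat; case: (w) w0 => //= a w' _; lia.
have := decB u; move/(congr1 size): zE; rewrite yE !size_cat.
case: (leqP M (size u)) => // uM; have := leq_mul (ltnW uM) (leqnn B).
by lia.
Qed.

(* The extension graph of z = p decode(u) w q is the image of that of u under
   the partial maps reading the letter next to p and to q. *)
Lemma eventually_treelike_of_derived :
  (forall u, derivedL u -> treelike (ext derivedL u)) ->
  exists N, forall z, L z -> N <= size z -> treelike (ext L z).
Proof.
move=> tree.
have [M MP] := eventually_double_star (N := 0) derived_is_language
  (fun u Lu _ => tree u Lu).
have [M' M'P] := long_parse M; exists M' => z Lz /(M'P _ Lz)[p [u [q [zE Mu pP qP]]]].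
(* Both relations are partial functions: a block need not be compatible with [p] or [q]. *)
pose EL a c := exists s, theta a = s ++ c :: p.
pose ER b d := exists s, theta b ++ w = (w ++ rcons q d) ++ s.
have ELfun a c c' : EL a c -> EL a c' -> c = c'.
  move=> [s sE] [s']; rewrite sE -!cat_rcons => /cat_injr /(congr1 (last c)).
  by rewrite !last_rcons.
have ERfun b d d' : ER b d -> ER b d' -> d = d'.
  move=> [s sE] [s']; rewrite {}sE -!catA !cat_rcons.
  move=> /(congr1 (drop (size (w ++ q)))); rewrite !(catA w q).
  by rewrite !drop_size_cat // => -[].
have extE c d : ext L z c d <-> exists a b, [/\ ext derivedL u a b, EL a c & ER b d].
  rewrite /ext zE; split=> [Lcd|[a [b [Lab [s aE] [s' bE]]]]]; last first.
    apply: (lang_factor HL (p := s) (q := s')).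
    move: Lab; rewrite /ext /derivedL decode_cons decode_rcons -!catA bE aE.
    by rewrite -!cats1 /= -!catA.
  (* [K] more letters on each side give return words around [decode u]; they reach beyond [p] and
     [q], because [p ++ w] and [w ++ q] contain [w] only at the end and at the beginning. *)
  have [t [Kt Lt]] := lang_extl_long HL K Lcd.
  have [t' [Kt' Lt']] := lang_extr_long K HL Lt.
  have [v vE] := decode_prefix u.
  have {}Lt' : L (t ++ c :: p ++ decode u ++ w ++ q ++ d :: t').
    by move: Lt'; rewrite -!cats1 -!catA /= -!catA.
  have Ll : L ((t ++ c :: p) ++ w).
    apply: (lang_prefix HL (q := v ++ q ++ d :: t')).
    by rewrite -catA (catA w v) -vE -!catA.
  have Lr : L (w ++ (rcons q d ++ t')).
    apply: (lang_suffix HL (p := t ++ c :: p ++ decode u)).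
    by rewrite -!catA /= -!catA cat_rcons.
  have [|s1 [s2 [tE sR]]] := return_suffix_complete HL w0 recw Ll.
    by rewrite size_cat; lia.
  have [|s3 [s4 [t'E s'R]]] := return_prefix_complete HL w0 recw Lr.
    by rewrite size_cat; lia.
  have /thetaP[a aE] := sR; have [b bE] := return_right_theta s'R.
  exists a, b; split.
  - rewrite /ext /derivedL decode_cons decode_rcons -!catA bE aE.
    apply: (lang_factor HL (p := s1) (q := s4)).
    move: Lt'; have -> : t ++ c :: p ++ decode u ++ w ++ q ++ d :: t' =
      (t ++ c :: p) ++ decode u ++ w ++ (rcons q d ++ t')
      by rewrite cat_rcons -catA.
    by rewrite tE t'E -!catA.
  - rewrite /EL aE; have [[[|c' e] [s1E pE]]|[e [te s2E]]] := cat_eq_cat tE.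
    + by exists [::].
    + case: pE => _ pE.
      have [_ _ [r [r0 s2r]] _] := sR.
      have /pP rr : p ++ w = e ++ w ++ r by rewrite pE -catA s2r.
      by rewrite rr in r0.
    + by exists e.
  - rewrite /ER bE; have [[e [s3E _]]|[e [qE _]]] := cat_eq_cat t'E.
      by exists e; rewrite s3E catA.
    have [|e0] := EM (e = [::]).
      by move=> e0; exists [::]; rewrite qE e0 !cats0.
    have [e' [d' eE]] : exists e' d', e = rcons e' d'.
      by case/lastP: (e) e0 => // e' d' _; exists e', d'.
    move: qE; rewrite eE -rcons_cat => /rcons_inj[qE _].
    have [_ [r [r0 s3r]] _ _] := s'R.
    have /qP rr : w ++ q = r ++ w ++ e' by rewrite qE catA s3r -catA.
    by rewrite rr in r0.
have Lu : derivedL u.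
  by apply: (lang_factor HL (p := p) (q := q)); rewrite -zE.
have [a0 [b0 [ab0 abl abr]]] := MP u Lu Mu.
apply: (treelike_ext (fun c d => iff_sym (extE c d))).
(* If both centres have images, the image is a double star; if only one has, it is a star; otherwise
   it is empty. *)
have [[c0 c0P]|nc] := EM (exists c, EL a0 c); last first.
  have [[d0 d0P]|nd] := EM (exists d, ER b0 d); last first.
    apply: treelike_empty => c d [a [b [ab ac bd]]].
    by case: (ab0 _ _ ab) => E; [apply: nc; exists c | apply: nd; exists d];
      rewrite -E.
  apply: treelike_sym; apply: (treelike_star (i0 := d0)) => d c [a [b [ab ac bd]]].
  case: (ab0 _ _ ab) => E; first by case: nc; exists c; rewrite -E.
  by apply: ERfun bd _; rewrite E.
have [[d0 d0P]|nd] := EM (exists d, ER b0 d); last first.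
  apply: (treelike_star (i0 := c0)) => c d [a [b [ab ac bd]]].
  case: (ab0 _ _ ab) => E; last by case: nd; exists d; rewrite -E.
  by apply: ELfun ac _; rewrite E.
apply: (treelike_double_star (i0 := c0) (j0 := d0)) => c d [a [b [ab ac bd]]].
- case: (ab0 _ _ ab) => E; [left | right].
    by apply: ELfun ac _; rewrite E.
  by apply: ERfun bd _; rewrite E.
- by exists a, b0; split=> //; apply: abl ab.
- by exists a0, b; split=> //; apply: abr ab.
Qed.

End DerivedLanguage.

(** * Shift spaces *)

Import GRing.Theory Num.Theory.
Local Open Scope ring_scope.

Lemma size_window (A : Type) (x : config A) i n : size (window x i n) = n.
Proof. exact: size_mkseq. Qed.

Lemma window_cat (A : Type) (x : config A) i m n :
  window x i (m + n) = window x i m ++ window x (i + m%:Z) n.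
Proof.
rewrite /window /mkseq iotaD map_cat; congr (_ ++ _).
rewrite -[in LHS](addn0 (0 + m)%N) iotaDl -map_comp; apply: eq_map => j /=.
by rewrite add0n PoszD addrA.
Qed.

Lemma window1 (A : Type) (x : config A) i : window x i 1 = [:: x i].
Proof. by rewrite /window /mkseq /=; congr [:: x _]; lia. Qed.

Lemma window_eq (A : Type) (x y : config A) i k n :
  (forall j : nat, (j < n)%N -> x (i + j%:Z) = y (k + j%:Z)) ->
  window x i n = window y k n.
Proof.
move=> H; apply/eq_in_map => j.
by rewrite mem_iota add0n => /andP[_ /H].
Qed.

Definition occ (A : Type) (x : config A) (i : int) (u : seq A) : Prop :=
  window x i (size u) = u.

Lemma occ_window (A : Type) (x : config A) i n : occ x i (window x i n).
Proof. by rewrite /occ size_window. Qed.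

Lemma occ_cat (A : Type) (x : config A) i u v :
  occ x i (u ++ v) <-> occ x i u /\ occ x (i + (size u)%:Z) v.
Proof.
rewrite /occ size_cat window_cat; split=> [E|[-> ->] //].
have E1 : window x i (size u) = u.
  by move/(congr1 (take (size u))): E; rewrite !take_size_cat ?size_window.
by move/(congr1 (drop (size u))): E; rewrite !drop_size_cat ?size_window.
Qed.

Lemma occ_prefix (A : Type) (x : config A) i u v :
  occ x i u -> occ x i v -> (size u <= size v)%N -> exists s, v = u ++ s.
Proof.
rewrite /occ => Eu Ev uv; exists (window x (i + (size u)%:Z) (size v - size u)).
by have := window_cat x i (size u) (size v - size u); rewrite subnKC // Eu Ev.
Qed.

Lemma inL_language (A : finType) (X : config A -> Prop) : is_language (inL X).
Proof.
split=> [p u q [x [i [Xx]]]|u [x [i [Xx E]]]|u [x [i [Xx E]]]].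
- by move=> /occ_cat[_ /occ_cat[E _]]; exists x, (i + (size p)%:Z).
- exists (x (i - 1)), x, (i - 1); split=> //.
  have -> : size (x (i - 1) :: u) = (1 + size u)%N by [].
  by rewrite window_cat subrK E window1.
exists (x (i + (size u)%:Z)), x, i; split=> //.
by rewrite size_rcons -addn1 window_cat E window1 cats1.
Qed.

Lemma shift_invariant_add (A : finType) (X : config A -> Prop) (x : config A) (k : int) :
  shift_invariant X -> X x -> X (fun i => x (i + k)).
Proof.
move=> inv; have pos (n : nat) y : X y <-> X (fun i => y (i + n%:Z)).
  elim: n y => [|n IH] y.
    suff -> : (fun i => y (i + 0%:Z)) = y by exact: iff_refl.
    by apply/funext => i; congr y; lia.
  rewrite (inv y) (IH (shift y)) /shift.
  suff -> : (fun i => y (i + n%:Z + 1)) = (fun i => y (i + n.+1%:Z)) by exact: iff_refl.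
  by apply/funext => i; congr y; lia.
case: k => n Xx; first exact: (pos n x).1.
apply: (pos n.+1 _).2.
suff -> : (fun i => x (i + n.+1%:Z + Negz n)) = x by [].
by apply/funext => i; congr x; lia.
Qed.

(** König's lemma: [good] words can be prolonged arbitrarily far on both sides, and nested good
    words around the origin define [x]. *)
Lemma compactness (A : finType) (T : seq A -> Prop) :
  (forall p u q, T (p ++ u ++ q) -> T u) ->
  (forall n, exists u, T u /\ (n <= size u)%N) ->
  exists x : config A, forall i n, T (window x i n).
Proof.
move=> Tfac Tlong.
pose good u := forall n, exists p q, [/\ size p = n, size q = n & T (p ++ u ++ q)].
have good0 : good [::].
  move=> n; have [u [Tu nu]] := Tlong (n + n)%N.
  exists (take n u), (take n (drop n u)); split.
  - by rewrite size_take; case: ltnP => //; lia.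
  - by rewrite size_take size_drop; case: ltnP => //; lia.
  apply: (Tfac [::] _ (drop n (drop n u))).
  by rewrite /= -catA cat_take_drop cat_take_drop.
have a0 : A by have [[|a u] []] := cid (Tlong 1%N).
have good_ext u : good u -> exists ab : A * A, good (ab.1 :: rcons u ab.2).
  move=> gu; have [//|no] := EM (exists ab : A * A, good (ab.1 :: rcons u ab.2)).
  (* If every pair of letters failed at some length, the maximum of these finitely many lengths
     would contradict that [u] is good. *)
  have /choice[m mP] : forall ab : A * A, exists n, forall p q,
      size p = n -> size q = n -> ~ T (p ++ (ab.1 :: rcons u ab.2) ++ q).
    move=> ab; have [//|no'] := EM (exists n, forall p q,
      size p = n -> size q = n -> ~ T (p ++ (ab.1 :: rcons u ab.2) ++ q)).
    case: no; exists ab => n.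
    have [//|no2] := EM (exists p q,
      [/\ size p = n, size q = n & T (p ++ (ab.1 :: rcons u ab.2) ++ q)]).
    case: no'; exists n => p q pn qn Tpq; apply: no2; exists p, q; split=> //.
  have [p [q [pn qn]]] := gu (\max_ab m ab).+1.
  case/lastP: p pn => // p a; rewrite size_rcons => -[pn].
  case: q qn => // b q [qn] TT.
  have mab : (m (a, b) <= size p)%N by rewrite pn; apply: leq_bigmax.
  rewrite -pn in qn.
  case: (mP (a, b) (drop (size p - m (a, b)) p) (take (m (a, b)) q)).
  - by rewrite size_drop; lia.
  - by rewrite size_take; case: ltnP => //; lia.
  apply: (Tfac (take (size p - m (a, b)) p) _ (drop (m (a, b)) q)).
  rewrite !catA cat_take_drop -!catA cat_take_drop /=.
  by move: TT; rewrite cat_rcons cat_rcons.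
have /choice[f fP] : forall u, exists ab : A * A, good u -> good (ab.1 :: rcons u ab.2).
  move=> u; have [/good_ext[ab gab]|nu] := EM (good u); first by exists ab.
  by exists (a0, a0).
pose s := fix s k := if k is k'.+1 then (f (s k')).1 :: rcons (s k') (f (s k')).2 else [::].
have sgood k : good (s k) by elim: k => //= k /fP.
have ssize k : size (s k) = k.*2 by elim: k => //= k IH; rewrite size_rcons IH doubleS.
(* [s k] occupies the positions from [-k] to [k - 1]; the index [(absz i).+1] is large enough for
   either sign of [i]. *)
pose x (i : int) := nth a0 (s (absz i).+1) (absz (i + (absz i).+1%:Z)).
have xP k (i : int) : (absz i < k)%N -> nth a0 (s k) (absz (i + k%:Z)) = x i.
  elim: k => // k IH; rewrite ltnS leq_eqVlt => /orP[/eqP<- //|ik].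
  rewrite -IH //; have -> : absz (i + k.+1%:Z) = (absz (i + k%:Z)).+1 by lia.
  rewrite /= nth_rcons ssize; case: ltnP => //; lia.
have xP2 k (i : int) : - (k%:Z) <= i < k%:Z -> nth a0 (s k) (absz (i + k%:Z)) = x i.
  move=> ik; have [|ki] := ltnP (absz i) k; first exact: xP.
  have E : i = - (k%:Z) by lia.
  rewrite -(xP k.+1); last by lia.
  have -> : absz (i + k.+1%:Z) = (absz (i + k%:Z)).+1 by lia.
  rewrite /= nth_rcons ssize; case: ltnP => //; lia.
have sw k : window x (- k%:Z) k.*2 = s k.
  apply: (@eq_from_nth _ a0); first by rewrite size_window ssize.
  move=> j; rewrite size_window => jk; rewrite nth_mkseq // -(xP2 k); last by lia.
  by congr (nth _ _ _); lia.
exists x => i n; pose k := (absz i + n)%N.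
have [p [q [_ _ /Tfac]]] := sgood k 0%N; rewrite -sw.
pose m := absz (i + k%:Z); have mE : m%:Z = i + k%:Z by rewrite /m /k; lia.
have -> : k.*2 = (m + (n + (k.*2 - n - m)))%N by move: mE; rewrite /k; lia.
by rewrite !window_cat mE addrC addrK; apply: Tfac.
Qed.

(* A word missing from arbitrarily long words of X would be missing from some
   point of X by compactness, and the points missing it form a subshift. *)
Lemma minimal_recurrent (A : finType) (X : config A -> Prop) (w : seq A) :
  minimal X -> inL X w -> exists K, recurrent_word (inL X) K w.
Proof.
move=> [[_ [clX invX]] minX] [x0 [i0 [Xx0 wx0]]].
have [//|no] := EM (exists K, recurrent_word (inL X) K w).
pose T u := inL X u /\ ~ exists p q, u = p ++ w ++ q.
have [||x xT] := @compactness A T.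
- move=> p u q [Lu nu]; split; first exact: (lang_factor (inL_language X) Lu).
  by move=> [p' [q' E]]; apply: nu; exists (p ++ p'), (q' ++ q); rewrite E -!catA.
- move=> n; have [//|nn] := EM (exists u, T u /\ (n <= size u)%N).
  case: no; exists n => u Lu nu.
  have [//|nw] := EM (exists p q, u = p ++ w ++ q).
  by case: nn; exists u.
have xw i : ~ occ x i w.
  move=> xi; have [_] := xT i (size w); rewrite xi; apply.
  by exists [::], [::]; rewrite cats0.
have Xx : X x.
  apply: clX => n; have [[y [j [Xy E]]] _] := xT (- n%:Z) (n.*2.+1).
  rewrite size_window in E.
  exists (fun i => y (i + (j + n%:Z))); split; first exact: (shift_invariant_add _ invX Xy).
  move=> i ni; have := congr1 (fun s => nth (x 0) s (absz (i + n%:Z))) E.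
  rewrite !nth_mkseq; [|lia|lia].
  have -> : j + (absz (i + n%:Z))%:Z = i + (j + n%:Z) by lia.
  by have -> : - n%:Z + (absz (i + n%:Z))%:Z = i by lia.
pose Y z := X z /\ forall i, ~ occ z i w.
have [_ nY] : Y x0.
  apply: minX => //; last by move=> z [].
  split; first by exists x.
  split.
    move=> z zY; split.
      by apply: clX => n; have [y [[Xy _] yz]] := zY n; exists y.
    (* The radius covers an occurrence of [w] at [i], which then passes to [y]. *)
    move=> i zi; have [y [[_ ny] yz]] := zY (absz i + size w)%N.
    apply: (ny i); rewrite /occ -[RHS]zi; apply: window_eq => j jw.
    by rewrite yz //; lia.
  move=> z; split=> [[Xz nz]|[Xz nz]]; split.
  - exact: (invX z).1.
  - move=> i zi; apply: (nz (i + 1)); rewrite /occ -[RHS]zi.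
    by apply: window_eq => j _; rewrite /shift; congr z; lia.
  - exact: (invX z).2.
  - move=> i zi; apply: (nz (i - 1)); rewrite /occ -[RHS]zi.
    by apply: window_eq => j _; rewrite /shift; congr z; lia.
by case: (nY i0).
Qed.

Lemma dendric_word_treelike (A : finType) (X : config A -> Prop) (w : seq A) :
  inL X w -> dendric_word X w <-> treelike (ext (inL X) w).
Proof.
move=> Lw; have HL := inL_language X.
apply: is_tree_treelike => //.
- by move=> a b; split=> /asboolP.
- by move=> [a|b] [a'|b'].
- move=> [a|b]; split=> [/asboolP Lv|[[u|u] //= /asboolP Lv]].
  + by have [b Lb] := lang_extr HL Lv; exists (inr b); apply/asboolP.
  + by apply/asboolP; apply: (lang_prefix HL (q := [:: u])); rewrite cats1.
  + by have [a La] := lang_extl HL Lv; exists (inl a); apply/asboolP.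
  + by apply/asboolP; apply: (lang_suffix HL (p := [:: u])).
by have [a La] := lang_extl HL Lw; exists (inl a); apply/asboolP.
Qed.

(** Among the positions from 0 to [size r], the last one always counts; if [w] is also a prefix, a
    total of two excludes exactly the interior ones. *)
Lemma return_wordE (A : finType) (X : config A -> Prop) (w r : seq A) :
  w <> [::] -> return_word X w r <-> complete_return (inL X) w (r ++ w).
Proof.
move=> w0; pose u := r ++ w.
pose P i := take (size w) (drop i u) == w.
have PP i : P i -> u = take i u ++ w ++ drop (i + size w) u.
  move=> /eqP wi; have := cat_take_drop (size w) (drop i u).
  by rewrite wi drop_drop addnC => ->; rewrite cat_take_drop.
have Pr : P (size r) by rewrite /P /u drop_size_cat // take_size.
have occE : r <> [::] -> occurrences w u = (P 0%N + count P (iota 1 (size r).-1)).+1.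
  move=> r0; change (count P (iota 0 (size u - size w).+1) =
    (P 0%N + count P (iota 1 (size r).-1)).+1).
  have rS : size r = (size r).-1.+1 by case: (r) r0.
  have c1 j : count P (iota j 1) = P j by rewrite /= addn0.
  have -> : (size u - size w).+1 = (1 + ((size r).-1 + 1))%N.
    by rewrite /u size_cat addnK; lia.
  rewrite !iotaD !count_cat !c1 add0n.
  have -> : (1 + (size r).-1)%N = size r by lia.
  by rewrite Pr addnA addn1.
split=> [[/eqP r0 [Lu [/prefixP[p up] occ2]]]|[Lu [r' [r0 E]] [p [p0 up]] H]].
  have P0 : P 0%N by rewrite /P drop0 /u up take_size_cat.
  move: occ2; rewrite -/u occE // P0 => -[/eqP]; rewrite -leqn0 leqNgt -has_count => nP.
  split=> //; first by exists r.
    exists p; split=> // p0; apply: r0; move/(congr1 size): up.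
    by rewrite p0 cats0 size_cat; case: (r) => //= a r'; lia.
  move=> x y E; have [->|/eqP x0] := EM (x = [::]); first by left.
  right; have [//|/eqP y0] := EM (y = [::]); case/negP: nP; apply/hasP.
  exists (size x); last by rewrite /P E drop_size_cat // take_size_cat.
  rewrite mem_iota; move/(congr1 size): E; rewrite /u !size_cat.
  have sx : (0 < size x)%N by case: (x) x0.
  have sy : (0 < size y)%N by case: (y) y0.
  by lia.
have {r0 E} r0 : r <> [::] by move/cat_injr: E => ->.
split; first exact/eqP.
split=> //; split; first by apply/prefixP; exists p.
rewrite -/u occE //.
have -> : P 0%N by rewrite /P drop0 /u up take_size_cat.
suff /negbTE nP : ~~ has P (iota 1 (size r).-1).
  by move: nP; rewrite has_count; case: count.
apply/hasPn => i; rewrite mem_iota => ir; apply/negP => /PP /H [].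
  by move/(congr1 size); rewrite size_take /u size_cat /=; case: ltnP; lia.
by move/(congr1 size); rewrite size_drop /u size_cat /=; lia.
Qed.

(** A return word longer than [K] would contain [w] after its first letter, an interior occurrence.
    So the return words are enumerated among the words of length at most [K]. *)
Lemma complete_return_coding (A : finType) (L : seq A -> Prop) (w : seq A) K :
  is_language L -> w <> [::] -> recurrent_word L K w ->
  exists n (theta : 'I_n -> seq A), injective theta /\
    forall r, complete_return L w (r ++ w) <-> exists i, theta i = r.
Proof.
move=> HL w0 recw.
have rK r : complete_return L w (r ++ w) -> (size r <= K)%N.
  case: r => // c r [Lr _ _ H]; rewrite leqNgt; apply/negP => /= Kr.
  have {}Lr : L r by apply: (lang_factor HL (p := [:: c]) (q := w)).
  have [p [q rE]] := recw _ Lr Kr.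
  have [|//|] := H (c :: p) (q ++ w); first by rewrite {1}rE /= -!catA.
  by move/(congr1 size); rewrite size_cat; case: (w) w0 => //= a w' _; lia.
pose s := [seq val b | b <- enum {: K.-bseq A} & `[< complete_return L w (val b ++ w) >]].
have us : uniq s.
  by rewrite (map_inj_uniq (@val_inj _ _ (K.-bseq A))) filter_uniq ?enum_uniq.
exists (size s), (fun i => nth [::] s i); split.
  by move=> i j /eqP; rewrite nth_uniq // => /eqP /val_inj.
move=> r; split=> [rr|[i <-]].
  have rs : r \in s.
    apply/mapP; exists (Bseq (rK r rr)) => //.
    by rewrite mem_filter mem_enum andbT; apply/asboolP.
  have ri : (index r s < size s)%N by rewrite index_mem.
  by exists (Ordinal ri); rewrite /= nth_index.
have /mapP[b] : nth [::] s i \in s by apply: mem_nth.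
by rewrite mem_filter => /andP[/asboolP H _] ->.
Qed.

(** * Block decompositions and the language of the derived shift *)

Section BlockStart.
Variables (A : finType) (n : nat) (theta : 'I_n -> seq A) (x : config A).
Variable y : config 'I_n.
Local Notation bs := (block_start theta y).

Lemma block_startS k : bs (k + 1) = bs k + (size (theta (y k)))%:Z.
Proof.
case: k => [m|[|m]].
- have -> : Posz m + 1 = Posz m.+1 by lia.
  by rewrite /= big_ord_recr.
- have -> : Negz 0 + 1 = Posz 0 by lia.
  rewrite /= big_ord0 big_ord1; have -> : - 1%:Z = Negz 0 by lia.
  by rewrite addNr.
have -> : Negz m.+1 + 1 = Negz m by lia.
rewrite /= [in RHS]big_ord_recr /=; have -> : - (m.+2)%:Z = Negz m.+1 by lia.
by lia.
Qed.

Hypothesis blocks : forall k, occ x (bs k) (theta (y k)).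

Lemma block_start_window i m :
  occ x (bs i) (decode theta (window y i m)).
Proof.
elim: m i => [|m IH] i; first by [].
rewrite -[m.+1]/(1 + m)%N window_cat window1 /= decode_cons.
by apply/occ_cat; split=> //; rewrite -block_startS.
Qed.
End BlockStart.

Section DerivedShift.
Variables (A : finType) (X : config A -> Prop) (w : seq A) (K n : nat).
Variable theta : 'I_n -> seq A.
Hypothesis invX : shift_invariant X.
Hypothesis w0 : w <> [::].
Hypothesis recw : recurrent_word (inL X) K w.
Hypothesis thetaI : injective theta.
Hypothesis thetaP : forall r,
  complete_return (inL X) w (r ++ w) <-> exists i, theta i = r.

Let HL := inL_language X.

(** The next [size w] blocks after [u] decode to a word at least as long as [w], which therefore
    begins with [w]. *)
Lemma inL_derived_decode u :
  inL (derived_shift X theta) u -> derivedL (inL X) w theta u.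
Proof.
move=> [y [i [[x [Xx blocks]] uE]]].
pose u' := window y (i + (size u)%:Z) (size w).
have := block_start_window blocks i (size u + size w)%N.
rewrite window_cat uE -/u' decode_cat.
have [v vE] := decode_prefix thetaP u'.
have u'w : (size w <= size (decode theta u'))%N.
  rewrite -{1}[size w](size_window y (i + (size u)%:Z)) -/u'.
  elim: (u') => // a s IH; rewrite decode_cons size_cat /=.
  case: (theta a) (@theta_neq0 _ _ _ _ _ thetaP a) => //= b t _.
  by rewrite addSn ltnS (leq_trans IH) // leq_addl.
have [[e [we _]]|[e [-> _]]] := cat_eq_cat vE.
  have /eqP e0 : e == [::].
    by move: u'w; rewrite {1}we size_cat -[leqRHS]addn0 leq_add2l leqn0 size_eq0.
  rewrite e0 cats0 in we; rewrite -we => H.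
  by exists x, (block_start theta y i); split.
rewrite catA => /occ_cat[H _].
by exists x, (block_start theta y i); split.
Qed.

Lemma next_return x i : X x -> occ x i w -> exists a, occ x i (theta a ++ w).
Proof.
move=> Xx xi; pose t := window x (i + (size w)%:Z) K.
have wt : occ x i (w ++ t) by apply/occ_cat; split=> //; apply: occ_window.
have [||s1 [s2 [tE cr]]] := return_prefix_complete HL w0 recw (t := t).
- by exists x, i.
- by rewrite size_window.
have [a aE] := return_right_theta thetaP cr.
by exists a; rewrite aE; move: wt; rewrite tE catA => /occ_cat[].
Qed.

Lemma prev_return x i : X x -> occ x i w ->
  exists a, occ x (i - (size (theta a))%:Z) (theta a ++ w).
Proof.
move=> Xx xi; pose t := window x (i - K%:Z) K.
have tw : occ x (i - K%:Z) (t ++ w).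
  by apply/occ_cat; split; [apply: occ_window | rewrite size_window subrK].
have [||s1 [s2 [tE cr]]] := return_suffix_complete HL w0 recw (t := t).
- by exists x, (i - K%:Z).
- by rewrite size_window.
have /thetaP[a aE] := cr; exists a.
move: tw; rewrite tE -catA aE => /occ_cat[_].
suff -> : i - K%:Z + (size s1)%:Z = i - (size s2)%:Z by [].
by move/(congr1 size): tE; rewrite size_window size_cat; lia.
Qed.

(** Return words are followed from the occurrence at 0, to the right through [F] and to the left
    through [G]. *)
Lemma exists_decoding x : X x -> occ x 0 w ->
  exists y, forall k, occ x (block_start theta y k) (theta (y k) ++ w).
Proof.
move=> Xx x0w; have [a0 _] := next_return Xx x0w.
(* The default [a0] serves positions without an occurrence of [w], which [F] and [G] never reach. *)
have /choice[nx nxP] : forall i, exists a, occ x i w -> occ x i (theta a ++ w).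
  move=> i; have [/(next_return Xx)[a aP]|nw] := EM (occ x i w); first by exists a.
  by exists a0.
have /choice[pv pvP] : forall i, exists a,
    occ x i w -> occ x (i - (size (theta a))%:Z) (theta a ++ w).
  move=> i; have [/(prev_return Xx)[a aP]|nw] := EM (occ x i w); first by exists a.
  by exists a0.
pose F := fix F m : int := if m is m'.+1 then F m' + (size (theta (nx (F m'))))%:Z else 0.
pose G := fix G m : int := if m is m'.+1 then G m' - (size (theta (pv (G m'))))%:Z else 0.
have Fw m : occ x (F m) w by elim: m => //= m /nxP /occ_cat[].
have Gw m : occ x (G m) w.
  elim: m => //= m IH; have [v vE] := decode_prefix thetaP [:: pv (G m)].
  move: (pvP _ IH); rewrite /decode /= cats0 in vE.
  by rewrite vE => /occ_cat[].
pose y k := match k with Posz m => nx (F m) | Negz m => pv (G m) end.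
have FE m : F m = block_start theta y (Posz m).
  by elim: m => [|m IH]; rewrite /= ?big_ord0 // big_ord_recr /= IH.
have GE m : G m.+1 = block_start theta y (Negz m).
  elim: m => [|m IH].
    by rewrite /= big_ord1 sub0r.
  have := block_startS theta y (Negz m.+1).
  have -> : Negz m.+1 + 1 = Negz m by lia.
  rewrite -IH => E.
  change (G m.+1 - (size (theta (pv (G m.+1))))%:Z = block_start theta y (Negz m.+1)).
  by rewrite {1}E addrK.
exists y => -[m|m].
  by rewrite -FE; apply: nxP (Fw m).
by rewrite -GE; apply: pvP (Gw m).
Qed.

(** By the prefix code property, complete return words occurring at the same position coincide, so
    the blocks are identified one after another. *)
Lemma decoding_unique x y k u :
  (forall j, occ x (block_start theta y j) (theta (y j) ++ w)) ->
  occ x (block_start theta y k) (decode theta u ++ w) -> window y k (size u) = u.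
Proof.
move=> yP; elim: u k => // a u IH k.
rewrite decode_cons -catA => au.
have aw : occ x (block_start theta y k) (theta a ++ w).
  move: au; have [v ->] := decode_prefix thetaP u.
  by rewrite catA => /occ_cat[].
have code b c : occ x (block_start theta y k) (theta b ++ w) ->
    occ x (block_start theta y k) (theta c ++ w) ->
    (size (theta b ++ w) <= size (theta c ++ w))%N -> b = c.
  move=> Hb Hc bc; have [s sE] := occ_prefix Hb Hc bc.
  have rb := theta_return thetaP b; have rc := theta_return thetaP c.
  have [_ _ [p [_ bp]] _] := rb.
  move: rb rc sE; rewrite bp => rb rc sE; rewrite sE -catA in rc.
  have s0 := return_prefix_code rc rb.
  by apply: thetaI; apply: (cat_injr (c := w)); rewrite sE s0 cats0 bp.
have ya : y k = a.
  have [le|/ltnW le] := leqP (size (theta (y k) ++ w)) (size (theta a ++ w)).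
    exact: code.
  by symmetry; apply: code.
rewrite -[size (a :: u)]/(1 + size u)%N window_cat window1 ya; congr (_ :: _).
apply: IH; rewrite block_startS ya.
by move: au => /occ_cat[].
Qed.

(** Conversely, an occurrence of [decode u ++ w] is moved to the origin and the point is decoded
    there; uniqueness makes the decoding start with [u]. *)
Lemma inL_derived_shift u :
  inL (derived_shift X theta) u <-> derivedL (inL X) w theta u.
Proof.
split=> [|[x [i [Xx ui]]]]; first exact: inL_derived_decode.
pose x' j := x (j + i); have Xx' : X x' := shift_invariant_add i invX Xx.
have x'u : occ x' 0 (decode theta u ++ w).
  rewrite /occ -[RHS]ui; apply: window_eq => j _.
  by rewrite /x'; congr x; lia.
have [|y yP] := exists_decoding Xx'.
  by move: x'u; have [v ->] := decode_prefix thetaP u => /occ_cat[].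
exists y, 0; split.
  by exists x'; split=> // k; have /occ_cat[] := yP k.
by apply: (decoding_unique yP); rewrite /= big_ord0.
Qed.

End DerivedShift.

(** * Equivalence of the three dendricity conditions *)

Theorem mainTheorem14 (A : finType) (X : config A -> Prop) :
  minimal X ->
  [<-> eventually_dendric X;
       exists w : seq A, w != [::] /\ inL X w /\ derived_dendric X w;
       exists N : nat, forall w : seq A, inL X w -> w != [::] ->
         (N <= size w)%N -> derived_dendric X w].
Proof.
move=> minX; have HL := inL_language X; have [[[x Xx] [_ invX]] _] := minX.
(* The implications established are (1) to (3), (3) to (2) and (2) to (1). *)
have H13 : eventually_dendric X -> exists N : nat, forall w : seq A,
    inL X w -> w != [::] -> (N <= size w)%N -> derived_dendric X w.
  move=> [N NP]; exists N => w Lw /eqP w0 Nw.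
  have [K recw] := minimal_recurrent minX Lw.
  have [n [theta [thetaI thetaP]]] := complete_return_coding HL w0 recw.
  exists n, theta; split.
    by split=> // r; rewrite (return_wordE X r w0).
  move=> u Lu; apply/dendric_word_treelike => //.
  have tree v : inL X v -> (N <= size v)%N -> treelike (ext (inL X) v).
    by move=> Lv /(NP _ Lv) /dendric_word_treelike; apply.
  apply: treelike_ext (derived_treelike HL w0 recw thetaI thetaP tree Nw u) => a b.
  exact: iff_sym (inL_derived_shift invX w0 recw thetaI thetaP _).
have H32 : (exists N : nat, forall w : seq A,
    inL X w -> w != [::] -> (N <= size w)%N -> derived_dendric X w) ->
    exists w : seq A, w != [::] /\ inL X w /\ derived_dendric X w.
  (* The successor keeps the word nonempty when [N] is 0. *)
  move=> [N NP]; exists (window x 0 N.+1).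
  have Lw : inL X (window x 0 N.+1) by exists x, 0; split=> //; apply: occ_window.
  by do 2!split=> //; apply: NP => //; rewrite size_window leqnSn.
have H21 : (exists w : seq A, w != [::] /\ inL X w /\ derived_dendric X w) ->
    eventually_dendric X.
  move=> [w [/eqP w0 [Lw [n [theta [[thetaI thetaR] den]]]]]].
  have [K recw] := minimal_recurrent minX Lw.
  have thetaP r : complete_return (inL X) w (r ++ w) <-> exists i, theta i = r.
    by rewrite -(return_wordE X r w0).
  have derE := inL_derived_shift invX w0 recw thetaI thetaP.
  have [|N NP] := eventually_treelike_of_derived HL w0 recw thetaP.
    move=> u /derE Lu; have /(dendric_word_treelike Lu) := den u Lu.
    by apply: treelike_ext => a b; apply: derE.
  exists N => v Lv Nv; apply/dendric_word_treelike => //; exact: NP.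
by tfae; [move=> /H13 /H32 | move=> /H21 /H13 | move=> /H32 /H21].
Qed.
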